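(* Let $(R,\mathfrak m,k)$ be a commutative noetherian local ring of depth $t$ and let $M$ be a finitely generated $R$-module of depth at least $t$. Then the module $\operatorname{Ext}^i_R(\operatorname{Tr}\Omega^t k,M)$ is a $k$-vector space for all integers $i>0$ and the following hold. (1) One has $\dim_k\operatorname{Ext}^i_R(\operatorname{Tr}\Omega^t k,M)=\beta_{t-i+1}(M)$ for all integers $1\le i\le t$. (2) One has $\dim_k\operatorname{Ext}^{t+1}_R(\operatorname{Tr}\Omega^t k,M)-\dim_k\operatorname{Ext}^{t+2}_R(\operatorname{Tr}\Omega^t k,M)=\beta_0(M)-\operatorname{r}(R)\mu_t(M)$. (3) One has $\dim_k\operatorname{Ext}^i_R(\operatorname{Tr}\Omega^t k,M)=\operatorname{r}(R)\mu_{i-2}(M)$ for all integers $i\ge t+3$.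
   Context: All modules are finitely generated. Write $(-)^\ast=\operatorname{Hom}_R(-,R)$. An $R$-module is said to be a $k$-vector space if it is annihilated by $\mathfrak m$. Syzygy and transpose: for a projective presentation $P_1\xrightarrow{\partial}P_0\to M\to 0$ (with $P_0,P_1$ finitely generated projective), the (first) syzygy is $\Omega M=\operatorname{Im}\partial$ and the (Auslander) transpose is $\operatorname{Tr}M=\operatorname{Coker}(\partial^\ast:P_0^\ast\to P_1^\ast)$. These are uniquely determined by $M$ up to projective summands. Put $\Omega^0M=M$ and $\Omega^nM=\Omega(\Omega^{n-1}M)$ for $n>0$. The $i$-th Betti number of $M$ is $\beta_i(M)=\dim_k\operatorname{Tor}^R_i(k,M)$ and the $i$-th Bass number of $M$ is $\mu_i(M)=\dim_k\operatorname{Ext}^i_R(k,M)$; both are $0$ for $i<0$. The type of $R$ is $\operatorname{r}(R)=\dim_k\operatorname{Ext}^{\operatorname{depth}R}_R(k,R)$. *)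

(* Defs.v *)
From HB Require Import structures.
From mathcomp Require Import all_boot all_algebra.
From mathcomp Require Import boolp classical_sets functions.
From mathcomp Require Import freeg.

Set Implicit Arguments.
Unset Strict Implicit.
Unset Printing Implicit Defensive.

Import GRing.Theory.
Local Open Scope ring_scope.
Local Open Scope quotient_scope.

(* Submodules are [submodClosed U] (decidable by classical logic); ideals of R *)
(* are [submodClosed R^o]. A submodule S has a module [submod S] of elements   *)
(* and a quotient module [quotmod S].                                          *)

Section Submodules.
Context {R : comNzRingType}.

Record submod (U : lmodType R) (S : submodClosed U) : Type :=
  Submod { submod_val :> U; _ : submod_val \in S }.

HB.instance Definition _ U S := [isSub for @submod_val U S].
HB.instance Definition _ U S := [Choice of @submod U S by <:].
HB.instance Definition _ U S := [SubChoice_isSubLmodule of @submod U S by <:].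

Definition kerp (U V : lmodType R) (f : {linear U -> V}) : {pred U} :=
  fun x => f x == 0.

Lemma kerp_closed U V f : subsemimod_closed (@kerp U V f).
Proof.
split; first split; first by rewrite unfold_in raddf0.
  by move=> x y; rewrite !unfold_in raddfD /= => /eqP-> /eqP->; rewrite addr0.
by move=> a x; rewrite !unfold_in linearZ /= => /eqP->; rewrite scaler0.
Qed.
HB.instance Definition _ U V f :=
  GRing.isSubmodClosed.Build R U (@kerp U V f) (@kerp_closed U V f).

Definition imp (U V : lmodType R) (f : {linear U -> V}) : {pred V} :=
  fun y => `[< exists x, f x = y >].

Lemma imp_closed U V f : subsemimod_closed (@imp U V f).
Proof.
split; first split; first by apply/asboolP; exists 0; rewrite raddf0.
  move=> _ _ /asboolP[x <-] /asboolP[y <-].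
  by apply/asboolP; exists (x + y); rewrite raddfD.
by move=> a _ /asboolP[x <-]; apply/asboolP; exists (a *: x); rewrite linearZ.
Qed.
HB.instance Definition _ U V f :=
  GRing.isSubmodClosed.Build R V (@imp U V f) (@imp_closed U V f).

Definition spanp (U : lmodType R) (A : set U) : {pred U} :=
  fun x =>
    `[< forall S : submodClosed U, (forall a, A a -> a \in S) -> x \in S >].

Lemma spanp_closed U A : subsemimod_closed (@spanp U A).
Proof.
split; first split; first by apply/asboolP => S _; apply: rpred0.
  move=> x y /asboolP xS /asboolP yS; apply/asboolP => S AS.
  by apply: rpredD; [apply: xS | apply: yS].
by move=> a x /asboolP xS; apply/asboolP => S AS; apply/rpredZ/xS.
Qed.
HB.instance Definition _ U A :=
  GRing.isSubmodClosed.Build R U (@spanp U A) (@spanp_closed U A).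

End Submodules.

Section Quotients.
Context {R : comNzRingType} (U : lmodType R) (S : submodClosed U).

Definition quotrel (x y : U) : bool := x - y \in S.

Lemma submod_opp x : (- x \in S) = (x \in S).
Proof.
by apply/idP/idP => xS; [rewrite -[x]opprK|]; rewrite -scaleN1r rpredZ.
Qed.

Lemma quotrel_refl : reflexive quotrel.
Proof. by move=> x; rewrite /quotrel subrr rpred0. Qed.

Lemma quotrel_sym : symmetric quotrel.
Proof. by move=> x y; rewrite /quotrel -submod_opp opprB. Qed.

Lemma quotrel_trans : transitive quotrel.
Proof.
move=> y x z xy yz; rewrite /quotrel -[x](subrK y) -addrA.
exact: rpredD xy yz.
Qed.

Canonical quot_equiv := EquivRel quotrel quotrel_refl quotrel_sym quotrel_trans.

Definition quotmod : Type := {eq_quot quotrel}.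
HB.instance Definition _ := Choice.on quotmod.
HB.instance Definition _ := EqQuotient.on quotmod.

Lemma pi_quotP (x y : U) :
  reflect (\pi_quotmod x = \pi_quotmod y) (x - y \in S).
Proof. by apply: (iffP idP) => [xy|/eqquotP//]; apply/eqquotP. Qed.

Lemma repr_quot (x : U) : repr (\pi_quotmod x) - x \in S.
Proof. by apply/pi_quotP; rewrite reprK. Qed.

Definition quot_opp (x : quotmod) : quotmod := \pi_quotmod (- repr x).
Definition quot_add (x y : quotmod) : quotmod := \pi_quotmod (repr x + repr y).
Definition quot_scale (a : R) (x : quotmod) : quotmod :=
  \pi_quotmod (a *: repr x).

Lemma pi_quot_opp x : quot_opp (\pi_quotmod x) = \pi_quotmod (- x).
Proof. by apply/pi_quotP; rewrite -opprD submod_opp repr_quot. Qed.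

Lemma pi_quot_add x y :
  quot_add (\pi_quotmod x) (\pi_quotmod y) = \pi_quotmod (x + y).
Proof. by apply/pi_quotP; rewrite opprD addrACA rpredD ?repr_quot. Qed.

Lemma pi_quot_scale a x : quot_scale a (\pi_quotmod x) = \pi_quotmod (a *: x).
Proof. by apply/pi_quotP; rewrite -scalerBr rpredZ ?repr_quot. Qed.

Lemma quot_addA : associative quot_add.
Proof.
elim/quotW=> x; elim/quotW=> y; elim/quotW=> z.
by rewrite (pi_quot_add x y) (pi_quot_add y z) !pi_quot_add addrA.
Qed.

Lemma quot_addC : commutative quot_add.
Proof. by elim/quotW=> x; elim/quotW=> y; rewrite !pi_quot_add addrC. Qed.

Lemma quot_add0 : left_id (\pi_quotmod 0) quot_add.
Proof. by elim/quotW=> x; rewrite pi_quot_add add0r. Qed.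

Lemma quot_addN : left_inverse (\pi_quotmod 0) quot_opp quot_add.
Proof. by elim/quotW=> x; rewrite (pi_quot_opp x) pi_quot_add addNr. Qed.

HB.instance Definition _ :=
  GRing.isZmodule.Build quotmod quot_addA quot_addC quot_add0 quot_addN.

Lemma quot_scaleA a b x : quot_scale a (quot_scale b x) = quot_scale (a * b) x.
Proof.
by elim/quotW: x => x; rewrite (pi_quot_scale b) !pi_quot_scale scalerA.
Qed.

Lemma quot_scale1 : left_id 1 quot_scale.
Proof. by elim/quotW=> x; rewrite pi_quot_scale scale1r. Qed.

Lemma quot_scaleDr : right_distributive quot_scale +%R.
Proof.
move=> a; elim/quotW=> x; elim/quotW=> y; rewrite /GRing.add /=.
by rewrite (pi_quot_add x y) !(pi_quot_scale a) pi_quot_add scalerDr.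
Qed.

Lemma quot_scaleDl x : {morph quot_scale^~ x : a b / a + b}.
Proof.
move=> a b; elim/quotW: x => x; rewrite [RHS]/GRing.add /=.
rewrite (pi_quot_scale a) (pi_quot_scale b) pi_quot_add pi_quot_scale.
by rewrite scalerDl.
Qed.

HB.instance Definition _ := GRing.Zmodule_isLmodule.Build R quotmod
  quot_scaleA quot_scale1 quot_scaleDr quot_scaleDl.

Definition quot_pi (x : U) : quotmod := \pi_quotmod x.

Lemma quot_pi_linear : linear quot_pi.
Proof.
by move=> a x y; rewrite /quot_pi -pi_quot_add -pi_quot_scale.
Qed.
HB.instance Definition _ :=
  GRing.isLinear.Build R U quotmod _ quot_pi quot_pi_linear.

Definition quot_lift (W : lmodType R) (g : {linear U -> W})
  (gS : forall x, x \in S -> g x = 0) (x : quotmod) : W := g (repr x).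

Lemma quot_lift_pi W g gS x : @quot_lift W g gS (quot_pi x) = g x.
Proof.
by apply/eqP; rewrite -subr_eq0 /quot_lift -raddfB; apply/eqP/gS/repr_quot.
Qed.

Lemma quot_lift_linear W g gS : linear (@quot_lift W g gS).
Proof.
move=> a; elim/quotW=> x; elim/quotW=> y.
by rewrite -!/(quot_pi _) -linearP !quot_lift_pi linearP.
Qed.
HB.instance Definition _ (W : lmodType R) g gS :=
  GRing.isLinear.Build R quotmod W _ (@quot_lift W g gS)
    (@quot_lift_linear W g gS).

End Quotients.

Section HomTensor.
Context {R : comNzRingType}.

Definition homp (U V : lmodType R) : {pred U -> V} := fun f => `[< linear f >].

Lemma homp_closed U V : subsemimod_closed (@homp U V).
Proof.
split; first split; first by apply/asboolP => a x y; rewrite scaler0 addr0.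
  move=> f g /asboolP fL /asboolP gL; apply/asboolP => a x y.
  by rewrite !fctE fL gL scalerDr addrACA.
move=> b f /asboolP fL; apply/asboolP => a x y.
by rewrite !fctE fL scalerDr !scalerA mulrC.
Qed.
HB.instance Definition _ (U V : lmodType R) :=
  GRing.isSubmodClosed.Build R (U -> V) (@homp U V) (@homp_closed U V).

(* The R-module Hom_R(U, V). *)
Definition Hom (U V : lmodType R) : lmodType R := submod (@homp U V).

Lemma precomp_homp (A B V : lmodType R) (f : {linear A -> B}) (g : Hom B V) :
  submod_val g \o f \in @homp A V.
Proof.
by case: g => g /= /asboolP gL; apply/asboolP => a x y /=; rewrite linearP gL.
Qed.

Definition precomp (A B V : lmodType R) (f : {linear A -> B}) (g : Hom B V) :
  Hom A V := Submod (precomp_homp f g).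

Lemma precomp_linear A B V f : linear (@precomp A B V f).
Proof. by move=> a g h; apply: val_inj. Qed.
HB.instance Definition _ (A B V : lmodType R) f :=
  GRing.isLinear.Build R (Hom B V) (Hom A V) _ (@precomp A B V f)
    (@precomp_linear A B V f).

Lemma fglift_linear (M : lmodType R) (K : choiceType) (f : K -> M) :
  linear (@fglift R M K f : {freeg K / R} -> M).
Proof.
have fB := lift_is_additive f.
have f0 : fglift f 0 = 0 by have := fB 0 0; rewrite !subrr.
have fN y : fglift f (- y) = - fglift f y by rewrite -sub0r fB f0 sub0r.
have fD x y : fglift f (x + y) = fglift f x + fglift f y.
  by rewrite -{1}[y]opprK fB fN opprK.
have fS (I : Type) (r : seq I) (F : I -> {freeg K / R}) :
    fglift f (\sum_(i <- r) F i) = \sum_(i <- r) fglift f (F i).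
  by elim: r => [|i r IHr]; rewrite ?big_nil // !big_cons fD IHr.
move=> a x y; rewrite fD; congr (_ + _).
rewrite -{2}[x]freeg_sumE {1}/GRing.scale /= /fgscale !fS scaler_sumr.
by apply: eq_bigr => i _; rewrite !liftU scalerA.
Qed.
HB.instance Definition _ (M : lmodType R) (K : choiceType) f :=
  GRing.isLinear.Build R {freeg K / R} M _ (@fglift R M K f)
    (@fglift_linear M K f).

Definition bilinear_rel (U V : lmodType R) : set {freeg (U * V) / R} :=
  fun x =>
     (exists u1 u2 v, x = << (u1 + u2, v) >> - << (u1, v) >> - << (u2, v) >>)
  \/ (exists u v1 v2, x = << (u, v1 + v2) >> - << (u, v1) >> - << (u, v2) >>)
  \/ (exists a u v, x = << (a *: u, v) >> - a *: << (u, v) >>)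
  \/ (exists a u v, x = << (u, a *: v) >> - a *: << (u, v) >>).

Definition tensor (U V : lmodType R) : lmodType R :=
  quotmod (spanp (@bilinear_rel U V)).

Definition tens (U V : lmodType R) (u : U) (v : V) : tensor U V :=
  quot_pi (spanp (@bilinear_rel U V)) << (u, v) >>.

Lemma tens_rel (U V : lmodType R) x : bilinear_rel x ->
  quot_pi (spanp (@bilinear_rel U V)) x = 0.
Proof.
move=> xr; rewrite -(raddf0 (quot_pi _)); apply/pi_quotP; rewrite subr0.
by apply/asboolP => S; apply.
Qed.

Lemma tensDl (U V : lmodType R) (u1 u2 : U) (v : V) :
  tens (u1 + u2) v = tens u1 v + tens u2 v.
Proof.
apply/eqP; rewrite -subr_eq0 opprD addrA -!raddfB; apply/eqP/tens_rel.
by left; exists u1, u2, v.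
Qed.

Lemma tensDr (U V : lmodType R) (u : U) (v1 v2 : V) :
  tens u (v1 + v2) = tens u v1 + tens u v2.
Proof.
apply/eqP; rewrite -subr_eq0 opprD addrA -!raddfB; apply/eqP/tens_rel.
by right; left; exists u, v1, v2.
Qed.

Lemma tensZl (U V : lmodType R) a (u : U) (v : V) :
  tens (a *: u) v = a *: tens u v.
Proof.
apply/eqP; rewrite -subr_eq0 -linearZ -raddfB; apply/eqP/tens_rel.
by right; right; left; exists a, u, v.
Qed.

Lemma tensZr (U V : lmodType R) a (u : U) (v : V) :
  tens u (a *: v) = a *: tens u v.
Proof.
apply/eqP; rewrite -subr_eq0 -linearZ -raddfB; apply/eqP/tens_rel.
by right; right; right; exists a, u, v.
Qed.

Definition tensor_pre (A B V : lmodType R) (f : {linear A -> B})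
  (p : A * V) : tensor B V := tens (f p.1) p.2.

Lemma tensor_map_rel (A B V : lmodType R) (f : {linear A -> B}) x :
  x \in spanp (@bilinear_rel A V) -> fglift (tensor_pre f) x = 0.
Proof.
move=> /asboolP/(_ (kerp (fglift (@tensor_pre A B V f)))) xr; apply/eqP/xr.
have fU (u : A) (v : V) : fglift (tensor_pre f) << (u, v) >> = tens (f u) v.
  by rewrite liftU scale1r.
move=> {xr}x; rewrite unfold_in => -[|[|[|]]] [? [? [? ->]]];
  rewrite !raddfB /= ?fU ?(raddfD f) ?(linearZ_LR f) /=
    ?(tensDl, tensDr, tensZl, tensZr).
- by rewrite -addrA -opprD subrr.
- by rewrite -addrA -opprD subrr.
- by rewrite (linearZ_LR (fglift _)) /= fU subrr.
- by rewrite (linearZ_LR (fglift _)) /= fU subrr.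
Qed.

(* The map f (x) id_V. *)
Definition tensor_map (A B V : lmodType R) (f : {linear A -> B}) :
  {linear tensor A V -> tensor B V} := quot_lift (@tensor_map_rel A B V f).

End HomTensor.

Section HomologicalAlgebra.
Context {R : comNzRingType}.

Definition bdyp (A B C : lmodType R) (f : {linear A -> B})
  (g : {linear B -> C}) : {pred submod (kerp g)} := fun z => submod_val z \in imp f.

Lemma bdyp_closed A B C f g : subsemimod_closed (@bdyp A B C f g).
Proof.
split; first split; first exact: (rpred0 (imp f)).
  by move=> x y; rewrite !unfold_in; apply: (rpredD (S := imp f)).
by move=> a x; rewrite !unfold_in; apply: (rpredZ (s := imp f)).
Qed.
HB.instance Definition _ (A B C : lmodType R) f g :=
  GRing.isSubmodClosed.Build R _ (@bdyp A B C f g) (@bdyp_closed A B C f g).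

(* Homology of A -f-> B -g-> C at B. *)
Definition homology (A B C : lmodType R) (f : {linear A -> B})
  (g : {linear B -> C}) : lmodType R := quotmod (@bdyp A B C f g).

Definition chain_homology (C : nat -> lmodType R)
    (d : forall i, {linear C i.+1 -> C i}) (i : nat) : lmodType R :=
  match i with
  | 0 => homology (d 0) (\0 : {linear C 0 -> C 0})
  | j.+1 => homology (d j.+1) (d j)
  end.

Definition cochain_cohomology (C : nat -> lmodType R)
    (d : forall i, {linear C i -> C i.+1}) (i : nat) : lmodType R :=
  match i with
  | 0 => homology (\0 : {linear C 0 -> C 0}) (d 0)
  | j.+1 => homology (d j) (d j.+1)
  end.

(* The standard free resolution of N: F_0 is the free module on the set N, and *)
(* F_(i+1) is the free module on the kernel of the previous map. Since derived *)
(* functors do not depend on the projective resolution, it serves to define    *)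
(* Ext and Tor as functions of the modules.                                    *)
Definition res_ker (N : lmodType R) : lmodType R :=
  submod (kerp (@fglift R N N id)).

Fixpoint res_syz (N : lmodType R) (i : nat) : lmodType R :=
  if i is j.+1 then res_ker (res_syz N j) else N.

Definition res_mod (N : lmodType R) (i : nat) : lmodType R :=
  {freeg (res_syz N i) / R}.

Definition res_diff (N : lmodType R) (i : nat) :
  {linear res_mod N i.+1 -> res_mod N i} :=
  @fglift R (res_mod N i) (res_syz N i.+1)
    (@submod_val R {freeg (res_syz N i) / R} (kerp (@fglift R _ _ id))).

Definition Ext (i : nat) (N V : lmodType R) : lmodType R :=
  @cochain_cohomology (fun j => Hom (res_mod N j) V)
    (fun j => precomp (res_diff N j)) i.

Definition Tor (i : nat) (N V : lmodType R) : lmodType R :=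
  @chain_homology (fun j => tensor (res_mod N j) V)
    (fun j => tensor_map V (res_diff N j)) i.

Definition fingen (M : lmodType R) : Prop :=
  exists n (g : 'I_n -> M), forall x, exists c : 'I_n -> R,
    x = \sum_i c i *: g i.

Definition projective (P : lmodType R) : Prop :=
  forall (U V : lmodType R) (q : {linear U -> V}) (g : {linear P -> V}),
  (forall v, exists u, q u = v) ->
  exists h : {linear P -> U}, forall x, q (h x) = g x.

(* A projective presentation P1 -> P0 -> M -> 0. *)
Record presentation (M : lmodType R) : Type := Presentation {
  pres1 : lmodType R;
  pres0 : lmodType R;
  pres_diff : {linear pres1 -> pres0};
  pres_aug : {linear pres0 -> M};
  pres1_fingen : fingen pres1;
  pres0_fingen : fingen pres0;
  pres1_projective : projective pres1;
  pres0_projective : projective pres0;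
  pres_aug_surj : forall x, exists y, pres_aug y = x;
  pres_exact : forall y, pres_aug y = 0 <-> exists z, pres_diff z = y }.

Definition syzygy (M : lmodType R) (p : presentation M) : lmodType R :=
  submod (imp (pres_diff p)).

Definition transpose (M : lmodType R) (p : presentation M) : lmodType R :=
  quotmod (imp (@precomp R _ _ R^o (pres_diff p))).

(* [is_syzygy n M X]: X is an n-th syzygy of M, for some choice of the         *)
(* successive projective presentations.                                        *)
Inductive is_syzygy : nat -> lmodType R -> lmodType R -> Prop :=
| is_syzygy0 M : is_syzygy 0 M M
| is_syzygyS n M X (p : presentation X) :
    is_syzygy n M X -> is_syzygy n.+1 M (syzygy p).

End HomologicalAlgebra.

Definition noetherian (R : comNzRingType) : Prop :=
  forall I : submodClosed R^o, fingen (submod I).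

Section LocalRings.
Context {R : comNzRingType}.
Implicit Types (m I J : submodClosed R^o) (M : lmodType R).

Definition maximal_ideal I : Prop :=
  1 \notin I /\ forall J, 1 \notin J -> {subset I <= J} -> J =i I.

Definition local_ring m : Prop :=
  maximal_ideal m /\ forall I, maximal_ideal I -> I =i m.

Definition residue_field m : lmodType R := quotmod m.

Definition is_kspace m M : Prop :=
  forall (a : R) (x : M), a \in m -> a *: x = 0.

Definition has_kdim m M (n : nat) : Prop :=
  exists f : {linear {ffun 'I_n -> residue_field m} -> M}, bijective f.

(* dim_k M, with default value 0 if M is not a finite-dimensional k-space. *)
Definition kdim m M : nat := xget 0%N [set n | has_kdim m M n].

Definition betti m i M : nat := kdim m (Tor i (residue_field m) M).
Definition bass m i M : nat := kdim m (Ext i (residue_field m) M).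

(* v belongs to (xs_0, ..., xs_(n-1)) M. *)
Definition in_idealM (xs : seq R) M (v : M) : Prop :=
  exists y : nat -> M, v = \sum_(j < size xs) xs`_j *: y j.

Definition regular_seq M (xs : seq R) : Prop :=
  (forall i, (i < size xs)%N -> forall v : M,
     in_idealM (take i xs) (xs`_i *: v) -> in_idealM (take i xs) v)
  /\ exists v : M, ~ in_idealM xs v.

(* depth M >= n; the zero module has infinite depth. *)
Definition depth_ge m M (n : nat) : Prop :=
  (forall v : M, v = 0) \/
  exists xs : seq R,
    [/\ size xs = n, forall x, x \in xs -> x \in m & regular_seq M xs].

Definition is_depth m M (t : nat) : Prop :=
  forall n, depth_ge m M n <-> (n <= t)%N.

Definition ring_type m : nat :=
  bass m (xget 0%N [set t | is_depth m R^o t]) R^o.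

End LocalRings.

(* Main.v *)
(** Resolve k by finitely generated projectives F so that T = Tr Omega^t k is
    the cokernel of F_t^* -> F_(t+1)^*. Since Ext^i(k, R) = 0 for i < t, the
    complex D : 0 -> F_0^* -> ... -> F_t^* -> F_(t+1)^* has homology T at its
    right end, Ext^t(k, R) = k^r at F_t^*, and nothing else. Killing k^r with a
    resolution L of k^r, shifted by two, turns D into a projective resolution
    of T, namely a mapping cone. Applying Hom(-, M), where
    Hom(F_j^*, M) = F_j (x) M, yields a long exact sequence

      Ext^(i-2)(k, M)^r -> Ext^i(T, M) -> Tor_(t+1-i)(k, M) -> Ext^(i-1)(k, M)^r

    for i > 0. As Ext^j(k, M) = 0 for j < t and Tor_j = 0 for j < 0, it
    degenerates to isomorphisms outside degrees t+1 and t+2, and to a four-term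
    exact sequence there. *)

From HB Require Import structures.
From mathcomp Require Import all_boot all_algebra.
From mathcomp Require Import boolp classical_sets functions.
From mathcomp Require Import freeg.
Require Import Defs.

Set Implicit Arguments.
Unset Strict Implicit.
Unset Printing Implicit Defensive.

Import GRing.Theory.
Local Open Scope ring_scope.

(** * Linear maps, Hom modules and subquotients *)

Section LinearMaps.
Context {R : comNzRingType}.
Implicit Types U V W : lmodType R.

(** The transpose comes from an arbitrary presentation of an arbitrary iterated syzygy, whereas
    [Ext] and [Tor] are computed from free modules on whole underlying sets. The given presentations
    are therefore spliced into one finitely generated resolution F of k whose dual has a cokernel
    literally equal to the transpose, and the comparison theorem replaces the standard resolutions
    by chosen ones. Finite generation of F makes each F_j^* projective and identifies F_j (x) M with
    Hom(F_j^*, M). The vector space claim does not follow from exactness alone, since an extension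
    of k-spaces need not be killed by m. Here no extension occurs: Ext^(t+1) embeds in Tor_0 by the
    depth of M, Ext^(t+2) is a quotient of Ext^t(k, M)^r because D ends in degree t+1, and in the
    other positive degrees Ext^i is isomorphic to a Tor or to Ext^(i-2)(k, M)^r. These are killed by
    m because multiplication by a in m on a resolution of k is null-homotopic, and additive functors
    preserve homotopies. Knowing the depth of R exactly identifies dim Ext^t(k, R) with the type. *)

Definition mklin U V (f : U -> V) (fL : linear f) : {linear U -> V} :=
  HB.pack f (GRing.isLinear.Build R U V _ f fL).

Lemma submod_of_pred U (P : U -> Prop) :
  P 0 -> (forall a x y, P x -> P y -> P (a *: x + y)) ->
  exists S : submodClosed U, forall x, (x \in S) = `[< P x >].
Proof.
move=> P0 PL; pose S : {pred U} := fun x => `[< P x >].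
have SC : subsemimod_closed S.
  split; first split; first exact/asboolP.
    move=> x y /asboolP Px /asboolP Py; apply/asboolP.
    by rewrite -[x]scale1r; apply: PL.
  by move=> a x /asboolP Px; apply/asboolP; rewrite -[_ *: _]addr0; apply: PL.
pose S' : submodClosed U := HB.pack S (GRing.isSubmodClosed.Build R U S SC).
by exists S'.
Qed.

Lemma impP U V (f : {linear U -> V}) y :
  reflect (exists x, f x = y) (y \in imp f).
Proof. exact: asboolP. Qed.

Lemma kerpP U V (f : {linear U -> V}) x : reflect (f x = 0) (x \in kerp f).
Proof. exact: eqP. Qed.

Lemma quot_pi_eq0 U (S : submodClosed U) x : quot_pi S x = 0 <-> x \in S.
Proof.
rewrite -(raddf0 (quot_pi S)) -{2}[x]subr0; split=> [e|e]; exact/pi_quotP.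
Qed.

Lemma quot_pi_surj U (S : submodClosed U) (y : quotmod S) :
  exists x, quot_pi S x = y.
Proof. by elim/quotW: y => x; exists x. Qed.

(** Injectivity of [q] makes the chosen preimages linear. Used to divide a map with values in xM by
    a regular x. *)
Lemma lift_linear U V W (f : {linear U -> W}) (q : {linear V -> W}) :
  injective q -> (forall x, exists y, q y = f x) ->
  exists h : {linear U -> V}, forall x, q (h x) = f x.
Proof.
move=> qI /choice[h hE].
have hL : linear h.
  by move=> a x y; apply: qI; rewrite hE !linearP !hE.
by exists (mklin hL).
Qed.

(** [projective] asks for a surjection; corestricting both maps to [imp q] provides one. This form
    lifts cycles along differentials, which are not onto. *)
Lemma projective_lift (P U V : lmodType R) (f : {linear P -> V}) (q : {linear U -> V}) :
  projective P -> (forall x, exists y, q y = f x) ->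
  exists h : {linear P -> U}, forall x, q (h x) = f x.
Proof.
move=> pP fq.
have qL : linear (fun y => Submod (introT (impP q (q y)) (ex_intro _ y erefl))).
  by move=> a x y; apply: val_inj; rewrite /= linearP.
have fI x : f x \in imp q by apply/impP; apply: fq.
have fL : linear (fun x => Submod (fI x)).
  by move=> a x y; apply: val_inj; rewrite /= linearP.
have [|h hE] := pP _ _ (mklin qL) (mklin fL).
  move=> [v vI]; have /impP[u uE] := vI; exists u; exact: val_inj.
by exists h => x; have /(congr1 val) := hE x.
Qed.

Lemma projective_zero (P : lmodType R) : (forall x : P, x = 0) -> projective P.
Proof.
move=> P0 U V q g _; exists \0 => x.
by rewrite [x]P0 !linear0.
Qed.

Lemma fglift_U (K : choiceType) V (f : K -> V) x : fglift f << x >> = f x.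
Proof. by rewrite liftU scale1r. Qed.

Lemma freeg_sumZ (K : choiceType) (D : {freeg K / R}) :
  D = \sum_(z <- dom D) coeff z D *: << z >>.
Proof.
rewrite -{1}[D]freeg_sumE; apply: eq_bigr => z _.
apply/eqP/freeg_eqP => y.
have -> : coeff y (coeff z D *: << z >>) = coeff z D * coeff y << z >>.
  exact: coeff_fgscale.
by rewrite !coeffU mul1r.
Qed.

Lemma freeg_ext (K : choiceType) V (f g : {linear {freeg K / R} -> V}) :
  (forall x, f << x >> = g << x >>) -> f =1 g.
Proof.
move=> fg D; rewrite [D]freeg_sumZ !linear_sum.
by apply: eq_bigr => z _; rewrite !linearZ fg.
Qed.

Lemma freeg_projective (K : choiceType) : projective {freeg K / R}.
Proof.
move=> U V q g qS.
have [h hE] := choice (fun x : K => qS (g << x >>)).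
exists (fglift h); apply: (@freeg_ext _ _ (q \o fglift h) g) => x /=.
by rewrite fglift_U hE.
Qed.

Lemma pair_projective U V : projective U -> projective V -> projective (U * V)%type.
Proof.
move=> pU pV A B q g qS.
have gL1 : linear (fun x : U => g (x, 0)).
  move=> a x y; rewrite -linearP; congr (g _).
  by congr pair; rewrite /= scaler0 addr0.
have gL2 : linear (fun x : V => g (0, x)).
  move=> a x y; rewrite -linearP; congr (g _).
  by congr pair; rewrite /= scaler0 addr0.
have [h1 h1E] := pU _ _ q (mklin gL1) qS.
have [h2 h2E] := pV _ _ q (mklin gL2) qS.
have hL : linear (fun x : U * V => h1 x.1 + h2 x.2).
  by move=> a x y; rewrite !linearP scalerDr addrACA.
exists (mklin hL) => -[x y] /=; rewrite linearD h1E h2E /= -linearD.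
by congr (g _); congr pair; rewrite /= ?addr0 ?add0r.
Qed.

Lemma submodP U (S : submodClosed U) (x : submod S) : submod_val x \in S.
Proof. by case: x. Qed.

Lemma submodB U (S : submodClosed U) x y : x \in S -> y \in S -> x - y \in S.
Proof. by move=> xS yS; rewrite rpredD // submod_opp. Qed.

Lemma submod_val_linear U (S : submodClosed U) : linear (@submod_val R U S).
Proof. by []. Qed.

HB.instance Definition _ U (S : submodClosed U) :=
  GRing.isLinear.Build R (submod S) U _ (@submod_val R U S)
    (@submod_val_linear U S).

Definition iso U V : Prop := exists f : {linear U -> V}, bijective f.

Lemma inj_surj_bij (A : choiceType) (B : Type) (f : A -> B) :
  injective f -> (forall y, exists x, f x = y) -> bijective f.
Proof.
move=> fI /choice[g gE]; exists g => // x; apply: fI; exact: gE.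
Qed.

Lemma linear_inj U V (f : {linear U -> V}) :
  (forall x, f x = 0 -> x = 0) -> injective f.
Proof.
by move=> f0 x y /eqP; rewrite -subr_eq0 -raddfB => /eqP/f0/eqP; rewrite subr_eq0 => /eqP.
Qed.

Lemma iso_sym U V : iso U V -> iso V U.
Proof.
move=> [f [g fK gK]].
have gL : linear g by move=> a x y; apply: (can_inj fK); rewrite linearP !gK.
by exists (mklin gL); exists f.
Qed.

Lemma iso_trans V U W : iso U V -> iso V W -> iso U W.
Proof.
move=> [f fB] [g gB]; exists (g \o f); exact: (bij_comp gB fB).
Qed.

End LinearMaps.

Section Homs.
Context {R : comNzRingType}.
Implicit Types U V W : lmodType R.

Definition happ U V (f : Hom U V) : U -> V := submod_val f.

Lemma happ_linear U V (f : Hom U V) : linear (happ f).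
Proof. by rewrite /happ; case: f => f /= /asboolP. Qed.

HB.instance Definition _ U V (f : Hom U V) :=
  GRing.isLinear.Build R U V _ (happ f) (happ_linear f).

Lemma linear_homp U V (f : {linear U -> V}) : (f : U -> V) \in @homp R U V.
Proof. by apply/asboolP; apply: linearP. Qed.

Lemma happB_arg U V (f : Hom U V) x y : happ f (x - y) = happ f x - happ f y.
Proof. exact: linearB. Qed.
Lemma happD_arg U V (f : Hom U V) x y : happ f (x + y) = happ f x + happ f y.
Proof. exact: linearD. Qed.
Lemma happZ_arg U V (f : Hom U V) a x : happ f (a *: x) = a *: happ f x.
Proof. exact: linearZ. Qed.
Lemma happN_arg U V (f : Hom U V) x : happ f (- x) = - happ f x.
Proof. exact: linearN. Qed.
Lemma happ0_arg U V (f : Hom U V) : happ f 0 = 0.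
Proof. exact: linear0. Qed.

Definition to_hom U V (f : {linear U -> V}) : Hom U V :=
  Submod (linear_homp f).

Lemma hom_ext U V (f g : Hom U V) : happ f =1 happ g -> f = g.
Proof. by move=> fg; apply: val_inj; apply: funext. Qed.

Lemma happ0 U V x : happ (0 : Hom U V) x = 0. Proof. by []. Qed.
Lemma happD U V (f g : Hom U V) x : happ (f + g) x = happ f x + happ g x.
Proof. by []. Qed.
Lemma happN U V (f : Hom U V) x : happ (- f) x = - happ f x.
Proof. by []. Qed.
Lemma happZ U V a (f : Hom U V) x : happ (a *: f) x = a *: happ f x.
Proof. by []. Qed.
Lemma happ_precomp U V W (f : {linear U -> V}) (g : Hom V W) x :
  happ (precomp f g) x = happ g (f x).
Proof. by []. Qed.

Lemma happ_sum U V (I : Type) (r : seq I) (F : I -> Hom U V) x :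
  happ (\sum_(i <- r) F i) x = \sum_(i <- r) happ (F i) x.
Proof.
by elim: r => [|i r IHr]; rewrite ?big_nil // !big_cons happD IHr.
Qed.

Definition happE := (happ_precomp, happ0, happD, happN, happZ, happ_sum).

Lemma precomp_eq U V W (f : {linear U -> V}) (g : Hom V W) (h : Hom U W) :
  precomp f g = h <-> forall x, happ g (f x) = happ h x.
Proof. by split=> [<- //|e]; apply: hom_ext. Qed.

Definition postcomp U V W (f : {linear V -> W}) (g : Hom U V) : Hom U W :=
  to_hom (f \o happ g).

Lemma postcomp_linear U V W f : linear (@postcomp U V W f).
Proof. by move=> a g h; apply: hom_ext => x; rewrite /happ /= linearP. Qed.
HB.instance Definition _ U V W f :=
  GRing.isLinear.Build R (Hom U V) (Hom U W) _ (@postcomp U V W f)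
    (@postcomp_linear U V W f).

End Homs.
Arguments happ {R U V} f x : simpl never.

(* [is_subquot Z Bd cls] presents H as Z / Bd for predicates Z, Bd on B; it is  *)
(* a single interface to the four shapes of (co)homology in Defs.              *)
Section Subquotients.
Context {R : comNzRingType}.
Implicit Types U V W B H : lmodType R.

Definition linear_pred B (Z : B -> Prop) : Prop :=
  Z 0 /\ forall a x y, Z x -> Z y -> Z (a *: x + y).

Record is_subquot B H (Z Bd : B -> Prop) (cls : B -> H) : Prop := IsSubquot {
  sq_lin : linear_pred Z;
  sq_clsP : forall a x y, Z x -> Z y -> cls (a *: x + y) = a *: cls x + cls y;
  sq_surj : forall h, exists2 x, Z x & cls x = h;
  sq_cls0 : forall x, Z x -> (cls x = 0 <-> Bd x) }.

Definition subquot B (Z Bd : B -> Prop) H : Prop :=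
  exists cls : B -> H, is_subquot Z Bd cls.

Lemma linear_predB B (Z : B -> Prop) x y :
  linear_pred Z -> Z x -> Z y -> Z (x - y).
Proof. by move=> [_ ZL] Zx Zy; rewrite addrC -scaleN1r; apply: ZL. Qed.

Lemma linear_predZ B (Z : B -> Prop) a x : linear_pred Z -> Z x -> Z (a *: x).
Proof. by move=> [Z0 ZL] Zx; rewrite -[_ *: _]addr0; apply: ZL. Qed.

Lemma sq_clsB B H (Z Bd : B -> Prop) (cls : B -> H) x y :
  is_subquot Z Bd cls -> Z x -> Z y -> cls (x - y) = cls x - cls y.
Proof.
by move=> [_ cP _ _] Zx Zy; rewrite addrC -scaleN1r cP // scaleN1r addrC.
Qed.

Lemma sq_clsZ B H (Z Bd : B -> Prop) (cls : B -> H) a x :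
  is_subquot Z Bd cls -> Z x -> cls (a *: x) = a *: cls x.
Proof.
move=> S Zx; have [Z0 _] := sq_lin S.
have c0 : cls 0 = 0 by have := sq_clsB S Z0 Z0; rewrite !subrr.
by rewrite -[_ *: _]addr0 (sq_clsP S) // c0 addr0.
Qed.

Lemma sq_eq B H (Z Bd : B -> Prop) (cls : B -> H) x y :
  is_subquot Z Bd cls -> Z x -> Z y -> (cls x = cls y <-> Bd (x - y)).
Proof.
move=> S Zx Zy; rewrite -(sq_cls0 S) ?(sq_clsB S) //; last first.
  exact: linear_predB (sq_lin S) Zx Zy.
by split=> [->|/eqP]; rewrite ?subrr // subr_eq0 => /eqP.
Qed.

Lemma homology_subquot U V W (f : {linear U -> V}) (g : {linear V -> W}) :
  subquot (fun z => g z = 0) (fun z => exists w, f w = z) (homology f g).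
Proof.
(* A class map must be defined on all of [V]; the value 0 off the kernel is never seen, as every
   clause of [is_subquot] is restricted to [Z]. *)
pose cls (x : V) : homology f g :=
  if insub x is Some z then quot_pi (@bdyp R U V W f g) z else 0.
have clsE x (xK : x \in kerp g) : cls x = quot_pi (@bdyp R U V W f g) (Submod xK).
  by rewrite /cls insubT.
exists cls; split.
- by split=> [|a x y gx gy]; rewrite ?linear0 // linearP gx gy scaler0 addr0.
- move=> a x y /kerpP xK /kerpP yK.
  have zK : a *: x + y \in kerp g by rewrite rpredD ?rpredZ.
  by rewrite !clsE -linearP; congr (quot_pi _ _); apply: val_inj.
- move=> h; have [[x xK] xE] := quot_pi_surj h.
  by exists x; [apply/kerpP | rewrite clsE].
- move=> x /kerpP xK; rewrite clsE quot_pi_eq0; split; first by move/impP.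
  by move=> xI; apply/impP.
Qed.

(** A chosen representative of each class is sent through [u]. The condition on boundaries removes
    the dependence on the choice, and linearity follows from that. *)
Lemma subquot_map B B' H H' (Z Bd : B -> Prop) (Z' Bd' : B' -> Prop)
    (cls : B -> H) (cls' : B' -> H') (u : {linear B -> B'}) :
    is_subquot Z Bd cls -> is_subquot Z' Bd' cls' ->
    (forall x, Z x -> Z' (u x)) -> (forall x, Z x -> Bd x -> Bd' (u x)) ->
  exists f : {linear H -> H'}, forall x, Z x -> f (cls x) = cls' (u x).
Proof.
move=> S S' uZ uBd.
have /choice[s sZ] : forall h, exists x, Z x /\ cls x = h.
  by move=> h; have [x] := sq_surj S h; exists x.
have fE x : Z x -> cls' (u (s (cls x))) = cls' (u x).
  move=> Zx; have [Zs sK] := sZ (cls x); apply/(sq_eq S'); [exact: uZ..|].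
  rewrite -raddfB; apply: uBd; first exact: linear_predB (sq_lin S) _ _.
  exact/(sq_eq S).
have fL : linear (fun h => cls' (u (s h))).
  move=> a h h'; have [Zh {1}<-] := sZ h; have [Zh' {1}<-] := sZ h'.
  rewrite -(sq_clsP S) // fE; last by have [_] := sq_lin S; apply.
  by rewrite linearP (sq_clsP S') //; apply: uZ.
by exists (mklin fL) => x /fE.
Qed.

(** Reflecting boundaries gives injectivity; for surjectivity it suffices to hit each cocycle up to
    a boundary. *)
Lemma subquot_iso B B' H H' (Z Bd : B -> Prop) (Z' Bd' : B' -> Prop)
    (u : {linear B -> B'}) :
    subquot Z Bd H -> subquot Z' Bd' H' ->
    (forall x, Z x -> Z' (u x)) -> (forall x, Z x -> (Bd x <-> Bd' (u x))) ->
    (forall y, Z' y -> exists2 x, Z x & Bd' (u x - y)) ->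
  iso H H'.
Proof.
move=> [cls S] [cls' S'] uZ uBd uS.
have [x Zx|f fE] := subquot_map S S' uZ; first by move/(uBd _ Zx).
exists f; apply: inj_surj_bij.
  apply: linear_inj => h; have [x Zx <-] := sq_surj S h; rewrite fE //.
  by move/(sq_cls0 S' (uZ _ Zx))/(uBd _ Zx)/(sq_cls0 S Zx).
move=> h; have [y Zy <-] := sq_surj S' h; have [x Zx xy] := uS y Zy.
by exists (cls x); rewrite fE //; apply/(sq_eq S') => //; apply: uZ.
Qed.

Lemma subquot_zero B (Z Bd : B -> Prop) H :
  subquot Z Bd H -> (forall x, Z x -> Bd x) -> forall h : H, h = 0.
Proof.
move=> [cls S] ZBd h; have [x Zx <-] := sq_surj S h.
by apply/(sq_cls0 S Zx)/ZBd.
Qed.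

Lemma subquot_zero_inv B (Z Bd : B -> Prop) H :
  subquot Z Bd H -> (forall h : H, h = 0) -> forall x, Z x -> Bd x.
Proof. by move=> [cls S] H0 x Zx; apply/(sq_cls0 S Zx). Qed.

Definition cocycle (C : nat -> lmodType R) (d : forall i, {linear C i -> C i.+1})
  i (z : C i) : Prop := d i z = 0.

Definition coboundary (C : nat -> lmodType R)
    (d : forall i, {linear C i -> C i.+1}) i : C i -> Prop :=
  match i with
  | 0 => fun z => z = 0
  | j.+1 => fun z => exists w, d j w = z
  end.

Definition chain_cycle (C : nat -> lmodType R)
    (d : forall i, {linear C i.+1 -> C i}) i : C i -> Prop :=
  match i with
  | 0 => fun z => True
  | j.+1 => fun z => d j z = 0
  end.

Definition chain_boundary (C : nat -> lmodType R)
    (d : forall i, {linear C i.+1 -> C i}) i (z : C i) : Prop :=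
  exists w, d i w = z.

Lemma eq_subquot B (Z Z' Bd Bd' : B -> Prop) H :
  (forall x, Z x <-> Z' x) -> (forall x, Bd x <-> Bd' x) ->
  subquot Z Bd H -> subquot Z' Bd' H.
Proof.
move=> ZE BdE; suff [-> ->] : Z = Z' /\ Bd = Bd' by [].
by split; apply: funext => x; apply: propext.
Qed.

Lemma cohomology_subquot (C : nat -> lmodType R) (d : forall i, {linear C i -> C i.+1}) i :
  subquot (@cocycle C d i) (@coboundary C d i) (cochain_cohomology d i).
Proof.
case: i => [|i]; apply: eq_subquot (homology_subquot _ _) => // x.
by split=> [[w <-]|->] //; exists 0.
Qed.

Lemma chain_homology_subquot (C : nat -> lmodType R) (d : forall i, {linear C i.+1 -> C i}) i :
  subquot (@chain_cycle C d i) (@chain_boundary C d i) (chain_homology d i).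
Proof. by case: i => [|i]; apply: eq_subquot (homology_subquot _ _). Qed.

End Subquotients.

(** * Projective resolutions and the comparison theorem *)

(** The next term exists only under the invariant [P], so the sequence is built together with proofs
    of it. [T] varies with the index because lifts in successive degrees have different types. *)
Lemma dependent_choice (T : nat -> Type) (P : forall i, T i -> Prop)
    (Q : forall i, T i -> T i.+1 -> Prop) (x0 : T 0%N) :
  P 0%N x0 -> (forall i x, P i x -> exists2 y, P i.+1 y & Q i x y) ->
  exists f : forall i, T i, f 0%N = x0 /\ forall i, Q i (f i) (f i.+1).
Proof.
move=> Px0 step.
have next i (s : {x | P i x}) : {y : {y | P i.+1 y} | Q i (sval s) (sval y)}.
  apply: cid; case: s => x Px; have [y Py xy] := step i x Px.
  by exists (exist _ y Py).
pose f := fix f i : {x | P i x} :=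
  if i is j.+1 then sval (next j (f j)) else exist _ x0 Px0.
exists (fun i => sval (f i)); split=> // i.
exact: (svalP (next i (f i))).
Qed.

Section Comparison.
Context {R : comNzRingType}.
Local Notation diffs K := (forall i, {linear K i.+1 -> K i}).
Implicit Types (C K L : nat -> lmodType R) (N V : lmodType R).

Definition chain_map K L (dK : diffs K) (dL : diffs L) (u : forall i, {linear K i -> L i}) :=
  forall i x, dL i (u i.+1 x) = u i (dK i x).

(** [h] is a family of bare functions, so that a difference such as v u - 1 can be written without
    bundling it as a linear map. *)
Definition null_homotopic K L (dK : diffs K) (dL : diffs L) (h : forall i, K i -> L i) : Prop :=
  exists s : forall i, {linear K i -> L i.+1},
    (forall x, h 0%N x = dL 0%N (s 0%N x)) /\
    (forall i x, h i.+1 x = dL i.+1 (s i.+1 x) + s i (dK i x)).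

Definition htpy_equiv K L (dK : diffs K) (dL : diffs L) : Prop :=
  exists (u : forall i, {linear K i -> L i}) (v : forall i, {linear L i -> K i}),
  [/\ chain_map dK dL u, chain_map dL dK v,
      null_homotopic dK dK (fun i x => v i (u i x) - x) &
      null_homotopic dL dL (fun i x => u i (v i x) - x)].

(** The invariant of the recursion is that the current map sends boundaries to boundaries: it
    provides the next lift, and exactness of [L] restores it. Starting from [f0] rather than from
    augmentations lets the lemma serve both for two resolutions and for the shifted complex D. *)
Lemma chain_map_lift K L (dK : diffs K) (dL : diffs L) (f0 : {linear K 0%N -> L 0%N}) :
    (forall i, projective (K i)) ->
    (forall i x, dK i (dK i.+1 x) = 0) ->
    (forall i y, dL i y = 0 -> exists z, dL i.+1 z = y) ->
    (forall x, exists z, dL 0%N z = f0 (dK 0%N x)) ->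
  exists2 u, u 0%N = f0 & chain_map dK dL u.
Proof.
move=> pK dKK exL f0P.
have [|i f fP|u [u0 uE]] := @dependent_choice (fun i => {linear K i -> L i})
  (fun i f => forall x, exists z, dL i z = f (dK i x))
  (fun i f f' => forall x, dL i (f' x) = f (dK i x)) f0.
- by [].
- have [f' f'E] := projective_lift (f := f \o dK i) (pK _) fP.
  exists f' => // x; apply: exL.
  by rewrite f'E /= dKK linear0.
- by exists u.
Qed.

(** The invariant is that the defect h_(i+1) - s_i d is a boundary: it is a cycle by the choice of
    s_i, and [L] is exact. *)
Lemma chain_map_null K L (dK : diffs K) (dL : diffs L) (h : forall i, {linear K i -> L i}) :
    (forall i, projective (K i)) ->
    (forall i x, dK i (dK i.+1 x) = 0) ->
    (forall i y, dL i y = 0 -> exists z, dL i.+1 z = y) ->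
    chain_map dK dL h ->
    (forall x, exists z, dL 0%N z = h 0%N x) ->
  null_homotopic dK dL h.
Proof.
move=> pK dKK exL hC h0P.
have [s0 s0E] := projective_lift (pK 0%N) h0P.
have [|i f fP|s [s0' sE]] := @dependent_choice (fun i => {linear K i -> L i.+1})
  (fun i f => forall x, exists z, dL i.+1 z = h i.+1 x - f (dK i x))
  (fun i f f' => forall x, dL i.+1 (f' x) = h i.+1 x - f (dK i x)) s0.
- by move=> x; apply: exL; rewrite linearB s0E hC subrr.
- have [f' f'E] := projective_lift (f := h i.+1 \- (f \o dK i)) (pK _) fP.
  exists f' => // x; apply: exL.
  by rewrite linearB f'E hC /= dKK linear0 subr0 subrr.
- exists s; split=> [x|i x]; first by rewrite s0' s0E.
  by rewrite sE subrK.
Qed.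

Lemma chain_htpy_iso K L (dK : diffs K) (dL : diffs L) i :
  htpy_equiv dK dL -> iso (chain_homology dK i) (chain_homology dL i).
Proof.
move=> [u [v [uC vC [s [s0 sS]] [s' [s'0 s'S]]]]].
apply: (subquot_iso (u := u i) (chain_homology_subquot _ _)
  (chain_homology_subquot _ _)); case: i => [|i] //=.
- by move=> x xZ; rewrite uC xZ linear0.
- move=> x _; split=> [[w <-]|[w wE]]; first by exists (u 1%N w); apply: uC.
  exists (v 1%N w - s 0%N x); rewrite linearB -s0 vC wE opprB addrC.
  by rewrite subrK.
- move=> x xZ; split=> [[w <-]|[w wE]]; first by exists (u i.+2 w); apply: uC.
  exists (v i.+2 w - s i.+1 x); rewrite linearB vC wE.
  have := sS i x; rewrite xZ linear0 addr0 => <-.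
  by rewrite opprB addrC subrK.
- by move=> y _; exists (v 0%N y) => //; exists (s' 0%N y).
- move=> y yZ; exists (v i.+1 y); first by rewrite vC yZ linear0.
  by exists (s' i.+1 y); rewrite s'S yZ linear0 addr0.
Qed.

Lemma cochain_htpy_iso K L (dK : diffs K) (dL : diffs L) V i :
  htpy_equiv dK dL ->
  iso (cochain_cohomology (C := fun j => Hom (K j) V) (fun j => precomp (dK j)) i)
      (cochain_cohomology (C := fun j => Hom (L j) V) (fun j => precomp (dL j)) i).
Proof.
move=> [u [v [uC vC [s [s0 sS]] [s' [s'0 s'S]]]]].
apply: (subquot_iso (u := precomp (v i)) (cohomology_subquot _ _)
  (cohomology_subquot _ _)).
- move=> f /precomp_eq fZ; apply/precomp_eq => x.
  by rewrite happ_precomp -vC fZ.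
- case: i => [|i] f /precomp_eq fZ /=.
    split=> [->|/precomp_eq fv]; first by rewrite linear0.
    apply: hom_ext => x; rewrite -[x](subKr (v 0%N (u 0%N x))) s0 happB_arg.
    by rewrite fZ fv subrr.
  split=> [[g /precomp_eq gE]|[g /precomp_eq gE]].
    by exists (precomp (v i) g); apply/precomp_eq => x; rewrite !happ_precomp -vC gE.
  (* From g d = f v, v u - 1 = d s + s d and f d = 0 one gets f = (g u - f s) d. *)
  exists (precomp (u i) g - precomp (s i) f); apply/precomp_eq => x.
  rewrite !happE -uC gE happ_precomp -happB_arg.
  have -> : v i.+1 (u i.+1 x) - s i (dK i x) = x + dK i.+1 (s i.+1 x).
    by apply/eqP; rewrite subr_eq -addrA -sS addrC subrK.
  by rewrite happD_arg fZ happ0 addr0.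
- move=> f /precomp_eq fZ; exists (precomp (u i) f).
    by apply/precomp_eq => x; rewrite happ_precomp -uC fZ.
  case: i f fZ => [|i] f fZ /=.
    by apply: hom_ext => x; rewrite !happE -happB_arg s'0 fZ.
  exists (precomp (s' i) f); apply/precomp_eq => x.
  by rewrite !happE -happB_arg s'S happD_arg fZ add0r.
Qed.

(** Each equivalence packs d d = 0 together with exactness. Finite generation is kept apart in
    [fg_resolution], as the standard resolution by free modules on whole sets has to be an
    instance. *)
Record resolution (N : lmodType R) : Type := Resolution {
  rmod : nat -> lmodType R;
  rdiff : forall i, {linear rmod i.+1 -> rmod i};
  raug : {linear rmod 0%N -> N};
  rproj : forall i, projective (rmod i);
  raug_surj : forall x, exists y, raug y = x;
  rexact0 : forall y, raug y = 0 <-> exists z, rdiff 0%N z = y;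
  rexact : forall i y, rdiff i y = 0 <-> exists z, rdiff i.+1 z = y }.

Arguments rdiff {N} r i.
Arguments raug {N} r.
Arguments rproj {N} r i.
Arguments raug_surj {N} r x.

Lemma rdiffK N (K : resolution N) i x : rdiff K i (rdiff K i.+1 x) = 0.
Proof. by apply/rexact; exists x. Qed.

Lemma raugK N (K : resolution N) x : raug K (rdiff K 0%N x) = 0.
Proof. by apply/rexact0; exists x. Qed.

Lemma resolution_map N (K L : resolution N) :
  exists2 u, chain_map (rdiff K) (rdiff L) u &
    forall x, raug L (u 0%N x) = raug K x.
Proof.
have [f0 f0E] := projective_lift (f := raug K) (rproj K 0%N)
  (fun x => raug_surj L (raug K x)).
have [||||u u0 uC] := @chain_map_lift _ _ (rdiff K) (rdiff L) f0.
- exact: rproj.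
- exact: rdiffK.
- by move=> i y /rexact.
- by move=> x; apply/rexact0; rewrite f0E raugK.
- by exists u => // x; rewrite u0.
Qed.

(** Such an [h] lifts the zero map of [N]. It yields both the uniqueness half of the comparison
    theorem and the annihilation of derived functors by the annihilator of [N]. *)
Lemma resolution_null N (K : resolution N) (h : forall i, {linear rmod K i -> rmod K i}) :
  chain_map (rdiff K) (rdiff K) h -> (forall x, raug K (h 0%N x) = 0) ->
  null_homotopic (rdiff K) (rdiff K) h.
Proof.
move=> hC h0; apply: chain_map_null hC _; first exact: rproj.
- exact: rdiffK.
- by move=> i y /rexact.
- by move=> x; apply/rexact0.
Qed.

Lemma resolution_htpy N (K L : resolution N) : htpy_equiv (rdiff K) (rdiff L).
Proof.
have [u uC u0] := resolution_map K L; have [v vC v0] := resolution_map L K.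
exists u, v; split=> //.
- apply: (@resolution_null _ K (fun i => (v i \o u i) \- idfun)) => [i x|x] /=.
    by rewrite linearB /= vC uC.
  by rewrite linearB /= v0 u0 subrr.
- apply: (@resolution_null _ L (fun i => (u i \o v i) \- idfun)) => [i x|x] /=.
    by rewrite linearB /= uC vC.
  by rewrite linearB /= u0 v0 subrr.
Qed.

Lemma res_diffU N i (x : res_syz N i.+1) : res_diff N i << x >> = submod_val x.
Proof. exact: fglift_U. Qed.

(** Factors the differential through the free cover of the next syzygy, so that both have the same
    kernel. *)
Lemma res_diffE N i y :
  res_diff N i y = submod_val (@fglift R (res_syz N i.+1) (res_syz N i.+1) id y).
Proof.
apply: (@freeg_ext _ _ _ (res_diff N i) (val \o fglift id)) => x /=.
by rewrite res_diffU fglift_U.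
Qed.

Lemma res_exact N i (y : res_mod N i) :
  @fglift R (res_syz N i) (res_syz N i) id y = 0 <-> exists z, res_diff N i z = y.
Proof.
split=> [y0|[z <-]].
  pose y' : res_syz N i.+1 := Submod (introT (kerpP _ y) y0).
  by exists << y' >>; rewrite res_diffU.
by rewrite res_diffE; apply/kerpP/submodP.
Qed.

(** Transparent, because [Ext_iso] and [Tor_iso] need [Ext] and [Tor] to be convertible with the
    (co)homology of this resolution. *)
Definition std_resolution N : resolution N.
Proof.
refine (@Resolution N (res_mod N) (res_diff N) (@fglift R N N id) _ _ _ _).
- by move=> i; apply: freeg_projective.
- by move=> x; exists << x >>; apply: fglift_U.
- exact: res_exact.
- move=> i y; rewrite -res_exact res_diffE; split=> [y0|->//].
  exact: val_inj.
Defined.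

Definition hom_cohomology N (K : resolution N) V i : lmodType R :=
  cochain_cohomology (C := fun j => Hom (rmod K j) V)
    (fun j => precomp (rdiff K j)) i.

Lemma Ext_iso N (K : resolution N) V i : iso (Ext i N V) (hom_cohomology K V i).
Proof. exact: cochain_htpy_iso (resolution_htpy (std_resolution N) K). Qed.

(** * Functoriality and additivity of the tensor product *)

Section TensorFunctor.
Variable V : lmodType R.
Implicit Types A B W : lmodType R.

Lemma tensor_mapE A B (f : {linear A -> B}) x y :
  tensor_map V f (tens x y) = tens (f x) y.
Proof.
exact: etrans (quot_lift_pi (@tensor_map_rel _ _ _ V f) _) (fglift_U _ _).
Qed.

Lemma tensor_ext A W (f g : {linear tensor A V -> W}) :
  (forall x y, f (tens x y) = g (tens x y)) -> f =1 g.
Proof.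
move=> fg z; have [x <-] := quot_pi_surj z.
apply: (@freeg_ext _ _ _ (f \o quot_pi _) (g \o quot_pi _)) => -[a b].
exact: fg.
Qed.

Lemma tensor_map_comp A B W (f : {linear A -> B}) (g : {linear B -> W}) x :
  tensor_map V g (tensor_map V f x) = tensor_map V (g \o f) x.
Proof.
apply: (@tensor_ext _ _ (tensor_map V g \o tensor_map V f)) => a b.
change (tensor_map V g (tensor_map V f (tens a b)) = tensor_map V (g \o f) (tens a b)).
by rewrite !tensor_mapE.
Qed.

Lemma tensor_mapD A B (f g h : {linear A -> B}) x :
  (forall x, h x = f x + g x) ->
  tensor_map V h x = tensor_map V f x + tensor_map V g x.
Proof.
move=> hE; apply: (@tensor_ext _ _ _ (tensor_map V f \+ tensor_map V g)) => a b.
change (tensor_map V h (tens a b) = tensor_map V f (tens a b) + tensor_map V g (tens a b)).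
by rewrite !tensor_mapE hE tensDl.
Qed.

Lemma eq_tensor_map A B (f g : {linear A -> B}) x :
  f =1 g -> tensor_map V f x = tensor_map V g x.
Proof. by move=> fg; apply: tensor_ext => a b; rewrite !tensor_mapE fg. Qed.

Lemma tensor_map_id A x : tensor_map V (idfun : {linear A -> A}) x = x.
Proof. by apply: (@tensor_ext _ _ _ idfun) => a b; rewrite tensor_mapE. Qed.

Lemma tensor_null_homotopic K L (dK : diffs K) (dL : diffs L)
    (u : forall i, {linear K i -> L i}) (v : forall i, {linear L i -> K i}) :
  null_homotopic dK dK (fun i x => v i (u i x) - x) ->
  null_homotopic (fun i => tensor_map V (dK i)) (fun i => tensor_map V (dK i))
    (fun i x => tensor_map V (v i) (tensor_map V (u i) x) - x).
Proof.
move=> [s [s0 sS]]; exists (fun i => tensor_map V (s i)); split=> [x|i x].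
  apply/eqP; rewrite subr_eq !tensor_map_comp -{3}[x]tensor_map_id; apply/eqP.
  by apply: tensor_mapD => y /=; rewrite -s0 subrK.
apply/eqP; rewrite subr_eq !tensor_map_comp -{4}[x]tensor_map_id; apply/eqP.
rewrite -(@tensor_mapD _ _ _ _ ((dK i.+1 \o s i.+1) \+ (s i \o dK i))) //.
by apply: tensor_mapD => y /=; rewrite -sS subrK.
Qed.

Lemma tensor_htpy_equiv K L (dK : diffs K) (dL : diffs L) :
  htpy_equiv dK dL ->
  htpy_equiv (fun i => tensor_map V (dK i)) (fun i => tensor_map V (dL i)).
Proof.
move=> [u [v [uC vC uv vu]]].
exists (fun i => tensor_map V (u i)), (fun i => tensor_map V (v i)); split.
- by move=> i x; rewrite !tensor_map_comp; apply: eq_tensor_map => y; apply: uC.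
- by move=> i x; rewrite !tensor_map_comp; apply: eq_tensor_map => y; apply: vC.
- exact: tensor_null_homotopic uv.
- exact: tensor_null_homotopic vu.
Qed.

End TensorFunctor.

Definition tensor_homology N (K : resolution N) V i : lmodType R :=
  chain_homology (C := fun j => tensor (rmod K j) V)
    (fun j => tensor_map V (rdiff K j)) i.

Lemma Tor_iso N (K : resolution N) V i : iso (Tor i N V) (tensor_homology K V i).
Proof.
exact: chain_htpy_iso (tensor_htpy_equiv V (resolution_htpy (std_resolution N) K)).
Qed.

End Comparison.
Arguments rdiff {R N} r i.
Arguments raug {R N} r.
Arguments rproj {R N} r i.
Arguments raug_surj {R N} r x.

(** * Finite generation over noetherian rings *)

Section FiniteGeneration.
Context {R : comNzRingType}.
Implicit Types U V M B H : lmodType R.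

Lemma fingen_fin M (I : finType) (g : I -> M) :
  (forall x, exists c : I -> R, x = \sum_i c i *: g i) -> fingen M.
Proof.
move=> gS; exists #|I|, (g \o enum_val) => x; have [c ->] := gS x.
exists (c \o enum_val); rewrite (reindex (fun j : 'I_#|I| => enum_val j)) //=.
by apply: onW_bij; exact: enum_val_bij.
Qed.

Lemma fingen_surj U V (f : {linear U -> V}) :
  (forall y, exists x, f x = y) -> fingen U -> fingen V.
Proof.
move=> fS [n [g gS]]; exists n, (f \o g) => y.
have [x <-] := fS y; have [c ->] := gS x; exists c.
by rewrite linear_sum; apply: eq_bigr => i _; rewrite linearZ.
Qed.

Lemma fingen_ffun n V : fingen V -> fingen {ffun 'I_n -> V}.
Proof.
move=> [k [g gS]].
pose b (p : 'I_n * 'I_k) : {ffun 'I_n -> V} :=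
  [ffun i => if i == p.1 then g p.2 else 0].
apply: (@fingen_fin _ _ b) => x.
have [c cE] := choice (fun i => gS (x i)).
exists (fun p => c p.1 p.2); apply/ffunP => i.
rewrite sum_ffunE cE -(pair_big predT predT (fun i0 j => (c i0 j *: b (i0, j)) i)) /=.
rewrite (bigD1 i) //= [X in _ + X]big1 ?addr0 => [|j ji]; last first.
  by apply: big1 => l _; rewrite !ffunE /= eq_sym (negPf ji) scaler0.
by apply: eq_bigr => l _; rewrite !ffunE /= eqxx.
Qed.

Lemma fingen_ring : fingen (R^o : lmodType R).
Proof.
exists 1%N, (fun=> 1) => x; exists (fun=> x).
by rewrite big_ord1 /GRing.scale /= mulr1.
Qed.

Lemma span_closed M n (g : 'I_n -> M) :
  linear_pred (fun x => exists c : 'I_n -> R, x = \sum_i c i *: g i).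
Proof.
split=> [|a x y [c ->] [c' ->]].
  by exists (fun=> 0); rewrite big1 // => i _; rewrite scale0r.
exists (fun i => a * c i + c' i); rewrite scaler_sumr -big_split /=.
by apply: eq_bigr => i _; rewrite scalerDl scalerA.
Qed.

Hypothesis Rn : noetherian R.

(** Induction on the number of ambient generators: the coefficients at the first generator that
    occur in S form an ideal, finitely many elements of S realise its generators, and what remains
    lies in the span of one generator fewer. The [g i] need not lie in S, which is what allows the
    induction. *)
Lemma noetherian_span n M (g : 'I_n -> M) (S : submodClosed M) :
    (forall x, x \in S -> exists c : 'I_n -> R, x = \sum_i c i *: g i) ->
  exists l (h : 'I_l -> M), (forall j, h j \in S) /\
    forall x, x \in S -> exists c : 'I_l -> R, x = \sum_j c j *: h j.
Proof.
elim: n g S => [|n IHn] g S gS.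
  exists 0%N, (fun=> 0); split=> [[]//|x /gS[c ->]].
  by exists (fun=> 0); rewrite !big_ord0.
pose g' i := g (fintype.lift ord0 i).
pose span x := exists c : 'I_n -> R, x = \sum_i c i *: g' i.
have spanP : linear_pred span := span_closed g'.
(* The generators may satisfy relations, so an element does not determine its coefficient at
   [g ord0]; [lead] collects all possible ones. *)
pose lead (a : R^o) := exists2 x, x \in S & span (x - a *: g ord0).
have [||I IE] := @submod_of_pred R R^o lead.
- exists 0; first exact: rpred0.
  by rewrite scale0r subr0; have [] := spanP.
- move=> a b b' [x xS xb] [x' x'S xb']; exists (a *: x + x').
    by rewrite rpredD ?rpredZ.
  have -> : a *: x + x' - (a *: b + b') *: g ord0 =
    a *: (x - b *: g ord0) + (x' - b' *: g ord0).
    by rewrite scalerBr scalerDl opprD addrACA scalerA.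
  by apply: spanP.2.
have [l [a aS]] := Rn I.
have /choice[y yE] : forall j, exists x, x \in S /\ span (x - submod_val (a j) *: g ord0).
  move=> j; have := submodP (a j); rewrite IE => /asboolP[x xS xa].
  by exists x.
have [||S' S'E] := @submod_of_pred R M (fun x => x \in S /\ span x).
- by split; [apply: rpred0 | apply: spanP.1].
- move=> b x x' [xS xs] [x'S x's]; split; first by rewrite rpredD ?rpredZ.
  exact: spanP.2.
have [x|l' [h [hS hE]]] := IHn g' S'; first by rewrite S'E => /asboolP[].
exists (l + l')%N, (fun j => match fintype.split j with inl i => y i | inr i => h i end).
split=> [j|x xS].
  case: (fintype.split j) => i; first by have [] := yE i.
  by have := hS i; rewrite S'E => /asboolP[].
have [c cE] := gS x xS.
have cI : c ord0 \in I.
  rewrite IE; apply/asboolP; exists x => //; exists (fun i => c (fintype.lift ord0 i)).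
  by rewrite cE big_ord_recl addrC addKr.
have [b bE] := aS (Submod cI).
have {}bE : c ord0 = \sum_j b j * submod_val (a j).
  have /(congr1 (@submod_val R R^o I)) /= -> := bE.
  by rewrite linear_sum.
(* The combination of the [y j] carries the same coefficient at [g ord0] as x, so the difference
   involves only the later generators. *)
have x'S : x - \sum_j b j *: y j \in S'.
  rewrite S'E; apply/asboolP; split.
    by apply: submodB => //; apply: rpred_sum => j _; apply: rpredZ; have [] := yE j.
  have -> : x - \sum_j b j *: y j = (x - c ord0 *: g ord0) -
      \sum_j b j *: (y j - submod_val (a j) *: g ord0).
    rewrite bE scaler_suml -addrA; congr (_ + _).
    rewrite -opprD -big_split /=; congr (- _); apply: eq_bigr => j _.
    by rewrite scalerBr scalerA addrC subrK.
  apply: linear_predB => //.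
    exists (fun i => c (fintype.lift ord0 i)).
    by rewrite cE big_ord_recl addrC addKr.
  apply: (big_ind span) => [|u v su sv|j _]; first exact: spanP.1.
    by rewrite -[u]scale1r; apply: spanP.2.
  by apply: linear_predZ => //; have [] := yE j.
have [c' c'E] := hE _ x'S.
exists (fun j => match fintype.split j with inl i => b i | inr i => c' i end).
rewrite big_split_ord /= -[x](subrK (\sum_j b j *: y j)) c'E addrC.
congr (_ + _); apply: eq_bigr => j _.
  by rewrite -[rshift _ _]/(unsplit (inr j)) unsplitK.
by rewrite -[lshift _ _]/(unsplit (inl j)) unsplitK.
Qed.

Lemma fingen_inj U V (f : {linear U -> V}) :
  injective f -> fingen V -> fingen U.
Proof.
move=> fI [n [g gS]].
have [x _|l [h [hS hE]]] := @noetherian_span n V g (imp f); first exact: gS.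
have /choice[y yE] : forall j, exists y, f y = h j by move=> j; apply/impP.
exists l, y => x; have [|c cE] := hE (f x); first by apply/impP; exists x.
exists c; apply: fI; rewrite cE linear_sum.
by apply: eq_bigr => j _; rewrite linearZ /= yE.
Qed.

Lemma fingen_submod U (S : submodClosed U) : fingen U -> fingen (submod S).
Proof. by apply: (@fingen_inj _ _ (@submod_val R U S)) => x y; apply: val_inj. Qed.

(** Evaluation at generators of [U] embeds the module of homomorphisms in a finite power of [V]. *)
Lemma fingen_Hom U V : fingen U -> fingen V -> fingen (Hom U V).
Proof.
move=> [n [g gS]] /(@fingen_ffun n) Vf.
have evL : linear (fun f : Hom U V => [ffun i => happ f (g i)]).
  by move=> a f f'; apply/ffunP => i; rewrite !ffunE.
apply: (@fingen_inj _ _ (mklin evL)) Vf.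
apply: linear_inj => f f0; apply: hom_ext => x; have [c ->] := gS x.
rewrite linear_sum happ0; apply: big1 => i _.
by have /ffunP/(_ i) := f0; rewrite !ffunE linearZ /= => ->; rewrite scaler0.
Qed.

Lemma fingen_subquot B H (Z Bd : B -> Prop) :
  subquot Z Bd H -> fingen B -> fingen H.
Proof.
move=> [cls S] Bf; have [Z0 ZL] := sq_lin S.
have [S' S'E] := submod_of_pred Z0 ZL.
have ZS (x : submod S') : Z (submod_val x) by apply/asboolP; rewrite -S'E submodP.
have cL : linear (fun x : submod S' => cls (submod_val x)).
  by move=> a x y; apply: (sq_clsP S a (ZS x) (ZS y)).
apply: (@fingen_surj _ _ (mklin cL)); last exact: fingen_submod.
move=> h; have [x Zx xE] := sq_surj S h.
have xS : x \in S' by rewrite S'E; apply/asboolP.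
by exists (Submod xS).
Qed.

End FiniteGeneration.

(** * Dimension over the residue field *)

Section Dimension.
Context {R : comNzRingType}.
Implicit Types (U V W : lmodType R) (I J : finType).
Variable m : submodClosed R^o.

(* Scalars are taken in R instead of k = R / m. *)
Definition kbasis V I (b : I -> V) : Prop :=
  [/\ is_kspace m V,
      forall x, exists c : I -> R, x = \sum_i c i *: b i &
      forall c : I -> R, \sum_i c i *: b i = 0 -> forall i, c i \in m].

Lemma idealM (a b : R) : b \in m -> a * b \in m.
Proof. by move=> bm; change ((a *: (b : R^o)) \in m); rewrite rpredZ. Qed.

Lemma residue_kspace : is_kspace m (residue_field m).
Proof.
move=> a x am; have [b <-] := quot_pi_surj x; rewrite -linearZ /=.
by apply/quot_pi_eq0; rewrite /GRing.scale /= mulrC idealM.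
Qed.

Lemma quot_pi_scale (a b : R) :
  quot_pi m (a * b : R^o) = a *: (quot_pi m (b : R^o) : residue_field m).
Proof. by rewrite -linearZ. Qed.

Lemma quot_pi_lin (a b c : R) : quot_pi m (a * b + c : R^o) =
  a *: (quot_pi m (b : R^o) : residue_field m) + quot_pi m (c : R^o).
Proof. exact: (linearP (quot_pi m)). Qed.

Lemma iso_kspace U V : iso U V -> is_kspace m V -> is_kspace m U.
Proof.
move=> [f /bij_inj fI] kV a x am; apply: fI.
by rewrite linearZ /= kV // linear0.
Qed.

Lemma iso_has_kdim U V n : iso U V -> has_kdim m U n -> has_kdim m V n.
Proof. by move=> [f fB] [g gB]; exists (f \o g); apply: bij_comp. Qed.

Lemma iso_kdim U V : iso U V -> kdim m U = kdim m V.
Proof.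
move=> UV; congr xget; apply/seteqP; split=> n /=; apply: iso_has_kdim => //.
exact: iso_sym.
Qed.

Lemma kbasis_iso U V I (b : I -> U) :
  iso U V -> kbasis b -> exists b' : I -> V, kbasis b'.
Proof.
move=> UV [kU bS bI]; have kV := iso_kspace (iso_sym UV) kU.
have [f [g fK gK]] := UV; exists (f \o b); split=> // [x|c].
  have [c cE] := bS (g x); exists c.
  by rewrite -[x]gK cE linear_sum; apply: eq_bigr => i _; rewrite linearZ.
move=> c0; apply: bI; apply: (can_inj fK); rewrite linear0 -c0 linear_sum.
by apply: eq_bigr => i _; rewrite linearZ.
Qed.

Lemma residue_ffun_basis n :
  kbasis (fun i : 'I_n => [ffun j => quot_pi m ((i == j)%:R : R^o)]
    : {ffun 'I_n -> residue_field m}).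
Proof.
have sumE (c : 'I_n -> R) (j : 'I_n) : (\sum_i c i *:
    ([ffun j => quot_pi m ((i == j)%:R : R^o)] : {ffun 'I_n -> residue_field m})) j
    = quot_pi m (c j : R^o).
  rewrite sum_ffunE (bigD1 j) //= !ffunE -quot_pi_scale eqxx mulr1.
  rewrite big1 ?addr0 // => i ij.
  by rewrite !ffunE -quot_pi_scale (negPf ij) mulr0 linear0.
split=> [a x am|x|c c0 j].
- by apply/ffunP => i; rewrite !ffunE residue_kspace.
- exists (fun j => sval (cid (quot_pi_surj (x j)))).
  by apply/ffunP => j; rewrite sumE; case: cid.
- by apply/quot_pi_eq0; rewrite -sumE c0 ffunE.
Qed.

Lemma has_kdim_basis V n : has_kdim m V n -> exists b : 'I_n -> V, kbasis b.
Proof. by move=> fB; apply: (kbasis_iso fB); apply: residue_ffun_basis. Qed.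

Lemma kbasis_has_kdim V I (b : I -> V) : kbasis b -> has_kdim m V #|I|.
Proof.
move=> [kV bS bI].
pose f (w : {ffun 'I_#|I| -> residue_field m}) : V :=
  \sum_i (repr (w (enum_rank i)) : R) *: b i.
(* Representatives in R of scalars in k may be chosen at will because m kills V. *)
have cE (a a' : R) v : quot_pi m (a : R^o) = quot_pi m (a' : R^o) ->
    a *: v = a' *: v :> V.
  move/(@pi_quotP R R^o m) => aa; apply/eqP.
  by rewrite -subr_eq0 -scalerBl kV.
have reprE (w : residue_field m) : quot_pi m (repr w) = w by apply: reprK.
have fL : linear f.
  move=> a w w'; rewrite /f scaler_sumr -big_split /=; apply: eq_bigr => i _.
  rewrite scalerA -scalerDl; apply: cE.
  by rewrite quot_pi_lin !reprE !ffunE.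
exists (mklin fL); apply: inj_surj_bij.
  apply: linear_inj => w /bI w0; apply/ffunP => i; rewrite ffunE.
  by rewrite -[LHS]reprE; apply/quot_pi_eq0; have := w0 (enum_val i); rewrite enum_valK.
move=> x; have [c ->] := bS x.
exists [ffun i => quot_pi m (c (enum_val i) : R^o)].
by apply: eq_bigr => i _; apply: cE; rewrite reprE ffunE enum_rankK.
Qed.

Hypothesis mM : maximal_ideal m.

(** [residue_field m] carries only a module structure; matrices need R/m as a nonzero commutative
    ring. *)
Lemma residue_ring : exists (Q : comNzRingType) (q : {rmorphism R -> Q}),
  forall a, q a = 0 <-> a \in m.
Proof.
pose S : {pred R} := fun x => x \in m.
have mC : idealr_closed S.
  split; [exact: (rpred0 m) | by have [] := mM |].
  by move=> a u v um vm; apply: (rpredD (S := m)) => //; apply: idealM.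
pose I : idealr R := HB.pack (S : R -> bool) (isIdealr.Build R S mC).
pose q : R -> {ideal_quot I} := fun x => (\pi x)%qT.
have qB : zmod_morphism q by move=> x y; rewrite /q !piE.
have qM : monoid_morphism q by split=> [|x y]; rewrite /q !piE.
pose q' : {rmorphism R -> {ideal_quot I}} := HB.pack q
  (GRing.isZmodMorphism.Build _ _ _ qB) (GRing.isMonoidMorphism.Build _ _ _ qM).
exists {ideal_quot I}, q' => a.
have -> : (q' a = 0) <-> (a - 0 \in I).
  have <- : q 0 = 0 by rewrite /q !piE.
  by rewrite Quotient.idealrBE; split=> [->|/eqP].
by rewrite subr0.
Qed.

(** Expanding each family in the other gives an n x n' and an n' x n matrix whose product is 1
    modulo m, which over a nonzero commutative ring forces the inequality. This is what makes [kdim]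
    well determined. *)
Lemma kbasis_leq V n n' (b : 'I_n -> V) (b' : 'I_n' -> V) :
  kbasis b -> kbasis b' -> (n <= n')%N.
Proof.
move=> [kV bS bI] [_ b'S _].
have [Q [q q0]] := residue_ring.
have /choice[A AE] := fun i => b'S (b i).
have /choice[B BE] := fun j => bS (b' j).
apply: (@mulmx1_min Q n n' (\matrix_(i, j) q (A i j)) (\matrix_(j, i) q (B j i))).
apply/matrixP => i l; rewrite !mxE.
have /bI/(_ l)/q0 : \sum_l (\sum_j A i j * B j l - (i == l)%:R) *: b l = 0.
  under eq_bigr do rewrite scalerBl scaler_suml.
  rewrite sumrB exchange_big /= [X in _ - X](bigD1 i) //= eqxx scale1r.
  rewrite [X in _ - (_ + X)]big1 ?addr0 => [|k]; last first.
    by rewrite eq_sym => /negPf ->; rewrite scale0r.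
  rewrite [X in _ - X]AE -sumrB big1 // => j _.
  under eq_bigr do rewrite -scalerA.
  by rewrite -scaler_sumr -BE subrr.
rewrite rmorphB rmorph_sum rmorph_nat => /eqP; rewrite subr_eq0 => /eqP <-.
by apply: eq_bigr => j _; rewrite !mxE rmorphM.
Qed.

Lemma kdim_eq V n : has_kdim m V n -> kdim m V = n.
Proof.
move=> Vn; apply: xget_unique => // n' Vn'.
have [[b bB] [b' bB']] := (has_kdim_basis Vn, has_kdim_basis Vn').
by apply/eqP; rewrite eqn_leq (kbasis_leq bB bB') (kbasis_leq bB' bB).
Qed.

Lemma kbasis_kdim V I (b : I -> V) : kbasis b -> kdim m V = #|I|.
Proof. by move=> /kbasis_has_kdim/kdim_eq. Qed.

Lemma maximal_inv (c : R) : c \notin m -> exists b, 1 - b * c \in m.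
Proof.
move=> cm.
(* J is m + Rc. It contains c, so by maximality it cannot be proper. *)
have [||J JE] := @submod_of_pred R R^o (fun a => exists b : R, a - b * c \in m).
- by exists 0; rewrite mul0r subr0 rpred0.
- move=> a x y [b xb] [b' yb']; exists (a * b + b').
  have -> : a *: x + y - (a * b + b') * c = a *: (x - b * c) + (y - b' * c).
    by rewrite /GRing.scale /= mulrDl mulrBr mulrA opprD addrACA.
  by rewrite rpredD ?rpredZ.
have [_ mM'] := mM.
have [J1 | /negPn] := boolP ((1 : R^o) \notin J); last first.
  by rewrite JE => /asboolP.
have mJ : {subset m <= J}.
  by move=> x xm; rewrite JE; apply/asboolP; exists 0; rewrite mul0r subr0.
have cJ : (c : R^o) \in J.
  by rewrite JE; apply/asboolP; exists 1; rewrite mul1r subrr rpred0.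
by case/negP: cm; rewrite -(mM' J J1 mJ).
Qed.

Lemma kbasis_exists V :
  fingen V -> is_kspace m V -> exists n (b : 'I_n -> V), kbasis b.
Proof.
move=> [n [g gS]] kV; elim: n g gS => [|n IHn] g gS.
  by exists 0%N, g; split=> // c _ [].
have [gI|] := pselect (forall c : 'I_n.+1 -> R, \sum_i c i *: g i = 0 ->
    forall i, c i \in m); first by exists n.+1, g; split.
move/existsNP => [c /not_implyP[c0 /existsNP[i0 /negP/maximal_inv[b bc]]]].
apply: (IHn (fun i => g (fintype.lift i0 i))) => x.
have [c' ->] := gS x.
(* As 1 - b c_i0 kills V, the relation gives g_i0 = - b times the sum of the other c_i g_i; this is
   substituted into x. *)
exists (fun i => c' (fintype.lift i0 i) - c' i0 * b * c (fintype.lift i0 i)).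
under [RHS]eq_bigr do rewrite scalerBl -scalerA.
rewrite sumrB -scaler_sumr (bigD1_ord i0) //= addrC; congr (_ + _).
move: c0; rewrite (bigD1_ord i0) //= addrC => /eqP; rewrite addr_eq0 => /eqP ->.
rewrite scalerN opprK scalerA -mulrA -scalerA; congr (_ *: _).
have := kV _ (g i0) bc; rewrite scalerBl scale1r => /eqP.
by rewrite subr_eq0 => /eqP.
Qed.

(** A basis of [U] is completed by lifts of a basis of [W]. That m kills [V] has to be assumed,
    since an extension of k-spaces need not be one. *)
Lemma kbasis_ses U V W I J (f : {linear U -> V}) (g : {linear V -> W})
    (bU : I -> U) (bW : J -> W) :
    is_kspace m V -> injective f -> (forall z, exists y, g y = z) ->
    (forall y, g y = 0 <-> exists x, f x = y) ->
    kbasis bU -> kbasis bW ->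
  exists b : I + J -> V, kbasis b.
Proof.
move=> kV fI gS fg [_ US UI] [_ WS WI].
have /choice[l lE] := fun j => gS (bW j).
pose b (k : I + J) := match k with inl i => f (bU i) | inr j => l j end.
have sumE (c : I + J -> R) : \sum_k c k *: b k =
    f (\sum_i c (inl i) *: bU i) + \sum_j c (inr j) *: l j.
  rewrite big_sumType /=; congr (_ + _); rewrite linear_sum.
  by apply: eq_bigr => i _; rewrite linearZ.
have glE (c : J -> R) : g (\sum_j c j *: l j) = \sum_j c j *: bW j.
  by rewrite linear_sum; apply: eq_bigr => j _; rewrite linearZ /= lE.
exists b; split=> // [y|c].
  have [c cE] := WS (g y).
  have /fg[x xE] : g (y - \sum_j c j *: l j) = 0 by rewrite linearB glE cE subrr.
  have [d dE] := US x.
  exists (fun k => match k with inl i => d i | inr j => c j end).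
  by rewrite sumE -dE xE subrK.
move=> c0; have cJ j : c (inr j) \in m.
  apply: (WI (fun j => c (inr j))); rewrite -glE.
  have /(congr1 g) := c0; rewrite sumE linearD linear0.
  by have -> : g (f (\sum_i c (inl i) *: bU i)) = 0; [apply/fg; eexists | rewrite add0r].
case=> [i|//]; apply: (UI (fun i => c (inl i))); apply: fI; rewrite linear0.
rewrite -c0 sumE [X in _ + X]big1 ?addr0 // => j _; exact: kV.
Qed.

Lemma kbasis_ffun V J n (b : J -> V) :
  kbasis b -> exists b' : 'I_n * J -> {ffun 'I_n -> V}, kbasis b'.
Proof.
move=> [kV bS bI].
pose b' (p : 'I_n * J) : {ffun 'I_n -> V} :=
  [ffun i => if i == p.1 then b p.2 else 0].
have sumE (c : 'I_n * J -> R) i : (\sum_p c p *: b' p) i = \sum_j c (i, j) *: b j.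
  rewrite sum_ffunE (eq_bigr (fun p => (c (p.1, p.2) *: b' (p.1, p.2)) i)); last by case.
  rewrite -(pair_bigA _ (fun i0 j => (c (i0, j) *: b' (i0, j)) i)) /=.
  rewrite (bigD1 i) //= [X in _ + X]big1 ?addr0 => [|k ki]; last first.
    by apply: big1 => l _; rewrite !ffunE /= eq_sym (negPf ki) scaler0.
  by apply: eq_bigr => l _; rewrite !ffunE /= eqxx.
exists b'; split=> [a x am|x|c c0 [i j]].
- by apply/ffunP => i; rewrite !ffunE kV.
- have /choice[c cE] := fun i => bS (x i).
  by exists (fun p => c p.1 p.2); apply/ffunP => i; rewrite sumE cE.
- by apply: (bI (fun j => c (i, j))); rewrite -sumE c0 ffunE.
Qed.

Lemma kspace_inj U V (f : {linear U -> V}) :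
  injective f -> is_kspace m V -> is_kspace m U.
Proof. by move=> fI kV a x am; apply: fI; rewrite linearZ /= kV ?linear0. Qed.

Lemma kspace_surj U V (f : {linear U -> V}) :
  (forall y, exists x, f x = y) -> is_kspace m U -> is_kspace m V.
Proof. by move=> fS kU a y am; have [x <-] := fS y; rewrite -linearZ kU ?linear0. Qed.

(** The sequence is cut at the image I of [v], so that dim A = dim E + dim I and dim B = dim I + dim
    F. The additive form avoids truncated subtraction. *)
Lemma kdim_exact4 (E A B F : lmodType R) (u : {linear E -> A})
    (v : {linear A -> B}) (w : {linear B -> F}) :
    noetherian R -> fingen A -> fingen B -> is_kspace m A -> is_kspace m B ->
    injective u -> (forall x, v x = 0 <-> exists y, u y = x) ->
    (forall x, w x = 0 <-> exists y, v y = x) -> (forall x, exists y, w y = x) ->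
  (kdim m E + kdim m B = kdim m A + kdim m F)%N.
Proof.
move=> Rn fA fB kA kB uI uv vw wS.
pose I := submod (imp v).
have vL : linear (fun x => Submod (introT (impP v (v x)) (ex_intro _ x erefl)) : I).
  by move=> a x y; apply: val_inj; rewrite /= linearP.
have vS (y : I) : exists x, mklin vL x = y.
  by case: y => y yI; have /impP[x xE] := yI; exists x; apply: val_inj.
have iI : injective (@submod_val R B (imp v)) by apply: val_inj.
have [n1 [b1 B1]] := kbasis_exists (fingen_inj Rn uI fA) (kspace_inj uI kA).
have [n2 [b2 B2]] := kbasis_exists (fingen_surj vS fA) (kspace_surj vS kA).
have [n3 [b3 B3]] := kbasis_exists (fingen_surj wS fB) (kspace_surj wS kB).
have [|bA BA] := kbasis_ses kA uI vS _ B1 B2.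
  by move=> y; rewrite -uv; split=> [/(congr1 val)//|y0]; apply: val_inj.
have [|bB BB] := kbasis_ses kB iI wS _ B2 B3.
  move=> y; rewrite vw; split=> [/impP yI|[[x xI] <-]]; first by exists (Submod yI).
  exact/impP.
rewrite (kbasis_kdim B1) (kbasis_kdim B3) (kbasis_kdim BA) (kbasis_kdim BB).
by rewrite !card_sum !card_ord addnA.
Qed.

End Dimension.

(** * Duality and tensor products *)

Section Duality.
Context {R : comNzRingType}.
Implicit Types A B P U V M N : lmodType R.

Definition dual P : lmodType R := Hom P R^o.

Definition dual_map A B (f : {linear A -> B}) : {linear dual B -> dual A} :=
  precomp f.

(** The dual basis criterion for finitely generated projectives. Unlike a splitting off a free
    module, it gives explicit formulas for duals and for Hom. *)
Definition has_dual_basis P : Prop :=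
  exists n (g : 'I_n -> P) (f : 'I_n -> dual P),
    forall x, x = \sum_i (happ (f i) x : R) *: g i.

Lemma has_dual_basis_fingen P : has_dual_basis P -> fingen P.
Proof. by move=> [n [g [f fg]]]; exists n, g => x; eexists; apply: fg. Qed.

Lemma has_dual_basis_projective P : has_dual_basis P -> projective P.
Proof.
move=> [n [g [f fg]]] U V q h qS.
have /choice[u uE] := fun i => qS (h (g i)).
have kL : linear (fun x => \sum_i (happ (f i) x : R) *: u i).
  move=> a x y; rewrite scaler_sumr -big_split /=; apply: eq_bigr => i _.
  by rewrite happD_arg happZ_arg scalerDl scalerA.
exists (mklin kL) => x /=; rewrite [in RHS](fg x) !linear_sum.
by apply: eq_bigr => i _; rewrite !linearZ uE.
Qed.

Lemma projective_dual_basis P : fingen P -> projective P -> has_dual_basis P.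
Proof.
move=> [n [g gS]] pP.
have qL : linear (fun x : {ffun 'I_n -> R^o} => \sum_i (x i : R) *: g i).
  move=> a x y; rewrite scaler_sumr -big_split /=; apply: eq_bigr => i _.
  by rewrite !ffunE scalerDl scalerA.
have [|h hE] := pP _ _ (mklin qL) idfun.
  move=> x; have [c ->] := gS x; exists [ffun i => c i].
  by apply: eq_bigr => i _; rewrite ffunE.
have fL i : linear (fun x => h x i : R^o).
  by move=> a x y; rewrite linearP !ffunE.
exists n, g, (fun i => to_hom (mklin (fL i))) => x.
by rewrite -[LHS]hE.
Qed.

(** The two families exchange roles: the [f i] generate, and evaluations at the [g i] are the
    coordinates. *)
Lemma dual_has_dual_basis P : has_dual_basis P -> has_dual_basis (dual P).
Proof.
move=> [n [g [f fg]]].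
have evL i : linear (fun phi : dual P => happ phi (g i)) by [].
exists n, f, (fun i => to_hom (mklin (evL i))) => phi.
apply: hom_ext => x; rewrite happ_sum {1}(fg x) linear_sum.
apply: eq_bigr => i _; rewrite happZ linearZ /=.
by rewrite /happ /= [RHS]mulrC.
Qed.

Section TensorHom.
Variable M : lmodType R.

Lemma tensor_hom_pre_linear P (p : P * M) :
  linear (fun phi : dual P => (happ phi p.1 : R) *: p.2).
Proof. by move=> a phi psi; rewrite happD happZ scalerDl scalerA. Qed.

Definition tensor_hom_pre P (p : P * M) : Hom (dual P) M :=
  to_hom (mklin (tensor_hom_pre_linear p)).

Lemma tensor_hom_preE P (p : P * M) phi :
  happ (tensor_hom_pre p) phi = (happ phi p.1 : R) *: p.2.
Proof. by []. Qed.

Lemma tensor_hom_rel P x :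
  x \in spanp (@bilinear_rel R P M) -> fglift (@tensor_hom_pre P) x = 0.
Proof.
move=> /asboolP/(_ (kerp (fglift (@tensor_hom_pre P)))) xr; apply/eqP/xr.
have fU p : fglift (@tensor_hom_pre P) << p >> = tensor_hom_pre p.
  exact: fglift_U.
have fB y z : fglift (@tensor_hom_pre P) (y - z) =
    fglift (@tensor_hom_pre P) y - fglift (@tensor_hom_pre P) z.
  exact: linearB.
have fZ a y : fglift (@tensor_hom_pre P) (a *: y) = a *: fglift (@tensor_hom_pre P) y.
  exact: linearZ.
move=> {xr}x; rewrite unfold_in => xr; apply/eqP/hom_ext => phi.
case: xr => [|[|[|]]] [? [? [? ->]]];
  rewrite /= !fB ?fZ !fU !(happD, happN, happZ) ?happ0 !tensor_hom_preE /=.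
- by rewrite happD_arg scalerDl -addrA -opprD subrr.
- by rewrite scalerDr -addrA -opprD subrr.
- by rewrite happZ_arg scalerA subrr.
- by rewrite !scalerA mulrC subrr.
Qed.

Definition tensor_hom P : {linear tensor P M -> Hom (dual P) M} :=
  quot_lift (@tensor_hom_rel P).

Lemma tensor_homE P (x : P) (y : M) phi :
  happ (tensor_hom P (tens x y)) phi = (happ phi x : R) *: y.
Proof.
have -> : tensor_hom P (tens x y) = tensor_hom_pre (x, y).
  exact: etrans (quot_lift_pi (@tensor_hom_rel P) _) (fglift_U _ _).
by [].
Qed.

Lemma tens_suml (I : finType) P (x : I -> P) (y : M) :
  tens (\sum_i x i) y = \sum_i tens (x i) y.
Proof.
have yL : linear (fun x : P => tens x y).
  by move=> a x1 x2; rewrite tensDl tensZl.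
exact: (linear_sum (mklin yL)).
Qed.

(** The inverse sends h to the sum of g_i (x) h(f_i). *)
Lemma tensor_hom_bij P : has_dual_basis P -> bijective (tensor_hom P).
Proof.
move=> [n [g [f fg]]].
have kL : linear (fun h : Hom (dual P) M => \sum_i tens (g i) (happ h (f i))).
  move=> a h h'; rewrite scaler_sumr -big_split /=; apply: eq_bigr => i _.
  by rewrite happD happZ tensDr tensZr.
exists (mklin kL).
  move=> z; apply: (@tensor_ext _ M P _ (mklin kL \o tensor_hom P) idfun) => x y.
  change (\sum_i tens (g i) (happ (tensor_hom P (tens x y)) (f i)) = tens x y).
  rewrite {2}(fg x) tens_suml; apply: eq_bigr => i _.
  by rewrite tensor_homE tensZr tensZl.
move=> h; apply: hom_ext => phi.
change (happ (tensor_hom P (\sum_i tens (g i) (happ h (f i)))) phi = happ h phi).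
rewrite linear_sum happ_sum.
under eq_bigr do rewrite tensor_homE.
have {2}-> : phi = \sum_i (happ phi (g i) : R) *: f i.
  apply: hom_ext => x; rewrite happ_sum {1}(fg x) linear_sum.
  apply: eq_bigr => i _; rewrite happZ linearZ /=.
  by rewrite /happ /= [RHS]mulrC.
by rewrite linear_sum; apply: eq_bigr => i _; rewrite linearZ.
Qed.

Lemma tensor_hom_nat A B (f : {linear A -> B}) z :
  tensor_hom B (tensor_map M f z) = precomp (dual_map f) (tensor_hom A z).
Proof.
apply: (@tensor_ext _ M A _ (tensor_hom B \o tensor_map M f)
  (precomp (dual_map f) \o tensor_hom A)) => x y.
change (tensor_hom B (tensor_map M f (tens x y)) =
  precomp (dual_map f) (tensor_hom A (tens x y))).
apply: hom_ext => phi.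
by rewrite tensor_mapE happ_precomp !tensor_homE.
Qed.

(** The form in which Tor appears once Hom(-, M) is applied to the dual of a resolution. *)
Definition bidual_homology N (K : resolution N) i : lmodType R :=
  chain_homology (C := fun j => Hom (dual (rmod K j)) M)
    (fun j => precomp (dual_map (rdiff K j))) i.

Lemma Tor_bidual N (K : resolution N) i :
  (forall j, fingen (rmod K j)) -> iso (Tor i N M) (bidual_homology K i).
Proof.
move=> Kf; apply: iso_trans (Tor_iso K M i) _.
have tB j := tensor_hom_bij (projective_dual_basis (Kf j) (rproj K j)).
have tI j := bij_inj (tB j).
apply: (subquot_iso (u := tensor_hom (rmod K i)) (chain_homology_subquot _ _)
  (chain_homology_subquot _ _)).
- case: i => [//|i] x x0; change (tensor_map M (rdiff K i) x = 0) in x0.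
  by apply: etrans (esym (tensor_hom_nat _ _)) _; rewrite x0 linear0.
- move=> x _; split=> [[w <-]|[w wE]].
    by exists (tensor_hom _ w); rewrite tensor_hom_nat.
  have [t _ tK] := tB i.+1; exists (t w); apply: tI.
  by rewrite tensor_hom_nat tK.
- move=> y y0; have [t _ tK] := tB i; exists (t y).
    case: i y y0 t tK => [//|i] y y0 t tK; apply: tI.
    by rewrite tensor_hom_nat tK linear0.
  by exists 0; rewrite tK subrr linear0.
Qed.

End TensorHom.
End Duality.

(** * Resolutions by finitely generated projectives *)

Section FiniteResolutions.
Context {R : comNzRingType}.
Implicit Types A B P U V M N X : lmodType R.

Definition fg_resolution N (K : resolution N) : Prop :=
  forall i, fingen (rmod K i).

Lemma free_dual_basis n : has_dual_basis {ffun 'I_n -> R^o}.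
Proof.
have cL (i : 'I_n) : linear (fun x : {ffun 'I_n -> R^o} => x i).
  by move=> a x y; rewrite !ffunE.
exists n, (fun i => [ffun j => (i == j)%:R]), (fun i => to_hom (mklin (cL i))).
move=> x; apply/ffunP => j; rewrite sum_ffunE (bigD1 j) //= big1 => [|i ij].
  by rewrite addr0 !ffunE eqxx /GRing.scale /= mulr1.
by rewrite !ffunE (negPf ij) scaler0.
Qed.

Lemma free_projective n : projective {ffun 'I_n -> R^o}.
Proof. exact: has_dual_basis_projective (free_dual_basis n). Qed.

Lemma free_fingen n : fingen {ffun 'I_n -> R^o}.
Proof. exact: has_dual_basis_fingen (free_dual_basis n). Qed.

Lemma fingen_cover N : fingen N ->
  exists n (f : {linear {ffun 'I_n -> R^o} -> N}), forall y, exists x, f x = y.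
Proof.
move=> [n [g gS]].
have fL : linear (fun x : {ffun 'I_n -> R^o} => \sum_i (x i : R) *: g i).
  move=> a x y; rewrite scaler_sumr -big_split /=; apply: eq_bigr => i _.
  by rewrite !ffunE scalerDl scalerA.
exists n, (mklin fL) => y; have [c ->] := gS y; exists [ffun i => c i].
by apply: eq_bigr => i _; rewrite ffunE.
Qed.

Lemma fg_resolution_exists N : noetherian R -> fingen N ->
  exists K : resolution N, fg_resolution K.
Proof.
move=> Rn Nf.
(* The recursion runs over modules bundled with their finite generation, on which the next cover
   depends. *)
have cov (S : {X : lmodType R | fingen X}) :
    {n : nat & {f : {linear {ffun 'I_n -> R^o} -> sval S} |
      forall y, exists x, f x = y}}.
  have [n nP] := cid (fingen_cover (svalP S)).
  by exists n; apply: cid.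
pose rk S := projT1 (cov S).
pose cv S : {linear {ffun 'I_(rk S) -> R^o} -> sval S} := sval (projT2 (cov S)).
have cvS S : forall y, exists x, cv S x = y := svalP (projT2 (cov S)).
pose kerS S : {X : lmodType R | fingen X} :=
  exist _ (submod (kerp (cv S)) : lmodType R)
    (@fingen_submod R Rn _ (kerp (cv S)) (free_fingen (rk S))).
pose syz := fix syz i : {X : lmodType R | fingen X} :=
  if i is j.+1 then kerS (syz j) else exist _ N Nf.
pose C i : lmodType R := {ffun 'I_(rk (syz i)) -> R^o}.
pose d i : {linear C i.+1 -> C i} :=
  (@submod_val R _ (kerp (cv (syz i)))) \o (cv (syz i.+1)).
have ex i (y : C i) : cv (syz i) y = 0 <-> exists z, d i z = y.
  split=> [y0|[z <-]]; last by apply/kerpP; apply: submodP.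
  have [z zE] := cvS (syz i.+1) (Submod (introT (kerpP _ y) y0)).
  by exists z; rewrite /d /= zE.
unshelve eexists (@Resolution R N C d (cv (syz 0%N)) _ _ _ _).
- by move=> i; apply: free_projective.
- exact: cvS (syz 0%N).
- exact: ex.
- move=> i y; rewrite -ex; split=> [y0|y0]; first exact: val_inj.
  by rewrite /d /= y0.
- by move=> i; apply: free_fingen.
Qed.

(** * Splicing presentations into a resolution *)

Section Prepend.
Variables (X : lmodType R) (p : presentation X) (G : resolution (syzygy p)).

(** [pres1 p] is dropped: [G] already starts with a cover of the syzygy. Hence the presentations
    used for successive syzygies need not match. *)
Definition prepend_mod i : lmodType R := if i is j.+1 then rmod G j else pres0 p.

Definition prepend_diff i : {linear prepend_mod i.+1 -> prepend_mod i} :=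
  match i return {linear prepend_mod i.+1 -> prepend_mod i} with
  | 0 => @submod_val R _ (imp (pres_diff p)) \o raug G
  | j.+1 => rdiff G j
  end.

Definition prepend : resolution X.
Proof.
refine (@Resolution R X prepend_mod prepend_diff (pres_aug p) _ _ _ _).
- by case=> [|i]; [apply: pres0_projective | apply: rproj].
- exact: pres_aug_surj.
- move=> y; rewrite pres_exact; split=> [/impP yI|[z <-]]; last first.
    by apply/impP; apply: submodP.
  by have [z zE] := raug_surj G (Submod yI); exists z; rewrite /= zE.
- case=> [|i] y; last exact: rexact.
  by rewrite /= -rexact0; split=> [y0|->//]; apply: val_inj.
Defined.

End Prepend.

Section Extend.
Variables (X : lmodType R) (p : presentation X).
Variable G : resolution (submod (kerp (pres_diff p)) : lmodType R).

(** Both modules of the presentation are kept, so that dualising the first differential gives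
    [transpose p] on the nose. *)
Definition extend_mod i : lmodType R :=
  match i with 0 => pres0 p | 1 => pres1 p | j.+2 => rmod G j end.

Definition extend_diff i : {linear extend_mod i.+1 -> extend_mod i} :=
  match i return {linear extend_mod i.+1 -> extend_mod i} with
  | 0 => pres_diff p
  | 1 => @submod_val R _ (kerp (pres_diff p)) \o raug G
  | j.+2 => rdiff G j
  end.

Definition extend : resolution X.
Proof.
refine (@Resolution R X extend_mod extend_diff (pres_aug p) _ _ _ _).
- case=> [|[|i]]; [exact: pres0_projective | exact: pres1_projective |].
  exact: rproj.
- exact: pres_aug_surj.
- exact: pres_exact.
- case=> [|[|i]] y; last exact: rexact.
    split=> [/kerpP yK|[z <-]]; last by apply/kerpP; apply: submodP.
    by have [z zE] := raug_surj G (Submod yK); exists z; rewrite /= zE.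
  by rewrite /= -rexact0; split=> [y0|->//]; apply: val_inj.
Defined.

End Extend.

Definition dual_coker N (F : resolution N) j : lmodType R :=
  quotmod (imp (dual_map (rdiff F j))).

(** Prepending a module only shifts the later differentials, so the cokernels agree by conversion
    and not merely up to isomorphism. All [i] are needed because each syzygy step moves the index by
    one. *)
Lemma syzygy_resolution n N X (G : resolution X) :
  is_syzygy n N X -> fg_resolution G ->
  exists2 F : resolution N, fg_resolution F &
    forall i, dual_coker F (n + i) = dual_coker G i.
Proof.
move=> S; elim: S G => [{}N|{}n {}N {}X p _ IHn] G Gf; first by exists G.
have [|F Ff FE] := IHn (prepend G).
  by case=> [|i]; [apply: pres0_fingen | apply: Gf].
by exists F => // i; rewrite addSnnS FE.
Qed.

(** Absorbs all choices hidden in [is_syzygy] and [p] into a single resolution; the rest of the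
    argument sees only that resolution. *)
Lemma transpose_resolution n N X (p : presentation X) :
  noetherian R -> is_syzygy n N X ->
  exists2 F : resolution N, fg_resolution F & transpose p = dual_coker F n.
Proof.
move=> Rn S.
have [G Gf] := fg_resolution_exists Rn
  (fingen_submod Rn (kerp (pres_diff p)) (pres1_fingen p)).
have [|F Ff FE] := syzygy_resolution (G := extend G) S.
  by case=> [|[|i]]; [apply: pres0_fingen | apply: pres1_fingen | apply: Gf].
by exists F => //; have := FE 0%N; rewrite addn0 => ->.
Qed.

(** * Finite powers of a resolution *)

Section Powers.
Variable r : nat.

Lemma ffun_map_linear U V (f : {linear U -> V}) :
  linear (fun w : {ffun 'I_r -> U} => [ffun j => f (w j)]).
Proof. by move=> a x y; apply/ffunP => j; rewrite !ffunE linearP. Qed.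

Definition ffun_map U V (f : {linear U -> V}) :
  {linear {ffun 'I_r -> U} -> {ffun 'I_r -> V}} := mklin (ffun_map_linear f).

Lemma ffun_mapE U V (f : {linear U -> V}) w j : ffun_map f w j = f (w j).
Proof. by rewrite ffunE. Qed.

Lemma ffun_map_eq U V (f : {linear U -> V}) w y :
  ffun_map f w = y <-> forall j, f (w j) = y j.
Proof.
by split=> [<- j|e]; [rewrite ffunE | apply/ffunP => j; rewrite ffunE].
Qed.

Definition ffun_inj U (j : 'I_r) (x : U) : {ffun 'I_r -> U} :=
  [ffun i => if i == j then x else 0].

Lemma ffun_inj_linear U j : linear (@ffun_inj U j).
Proof.
by move=> a x y; apply/ffunP => i; rewrite !ffunE; case: ifP; rewrite // scaler0 addr0.
Qed.
HB.instance Definition _ U j :=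
  GRing.isLinear.Build R U {ffun 'I_r -> U} _ (@ffun_inj U j) (@ffun_inj_linear U j).

Lemma ffun_sum_inj U (w : {ffun 'I_r -> U}) : w = \sum_j ffun_inj j (w j).
Proof.
apply/ffunP => i; rewrite sum_ffunE (bigD1 i) //= big1 => [|j ji].
  by rewrite addr0 ffunE eqxx.
by rewrite ffunE eq_sym (negPf ji).
Qed.

Lemma ffun_map_inj U V (f : {linear U -> V}) j x :
  ffun_map f (ffun_inj j x) = ffun_inj j (f x).
Proof.
by apply/ffunP => i; rewrite !ffunE; case: ifP; rewrite ?linear0.
Qed.

Lemma ffun_projective P : projective P -> projective {ffun 'I_r -> P}.
Proof.
move=> pP U V q g qS.
have /choice[h hE] : forall j, exists h : {linear P -> U},
    forall x, q (h x) = g (ffun_inj j x).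
  by move=> j; apply: (pP _ _ q (g \o ffun_inj j)).
have hL : linear (fun w : {ffun 'I_r -> P} => \sum_j h j (w j)).
  move=> a x y; rewrite scaler_sumr -big_split /=; apply: eq_bigr => j _.
  by rewrite !ffunE linearP.
exists (mklin hL) => w /=; rewrite [in RHS](ffun_sum_inj w) !linear_sum.
by apply: eq_bigr => j _; rewrite hE.
Qed.

Definition power_resolution N (K : resolution N) : resolution {ffun 'I_r -> N}.
Proof.
refine (@Resolution R {ffun 'I_r -> N} (fun i => {ffun 'I_r -> rmod K i})
  (fun i => ffun_map (rdiff K i)) (ffun_map (raug K)) _ _ _ _).
- by move=> i; apply: ffun_projective; apply: rproj.
- move=> y; have /choice[x xE] := fun j => raug_surj K (y j).
  by exists [ffun j => x j]; apply/ffun_map_eq => j; rewrite ffunE.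
- move=> y; rewrite ffun_map_eq; split=> [y0|[z /ffun_map_eq zE] j]; last first.
    by rewrite ffunE; apply/rexact0; exists (z j).
  have /choice[z zE] j : exists z, rdiff K 0%N z = y j.
    by apply/rexact0; rewrite y0 ffunE.
  by exists [ffun j => z j]; apply/ffun_map_eq => j; rewrite ffunE.
- move=> i y; rewrite ffun_map_eq; split=> [y0|[z /ffun_map_eq zE] j]; last first.
    by rewrite ffunE; apply/rexact; exists (z j).
  have /choice[z zE] j : exists z, rdiff K i.+1 z = y j.
    by apply/rexact; rewrite y0 ffunE.
  by exists [ffun j => z j]; apply/ffun_map_eq => j; rewrite ffunE.
Defined.

Lemma power_diff_inj N (K : resolution N) i j x :
  rdiff (power_resolution K) i (ffun_inj j x) = ffun_inj j (rdiff K i x).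
Proof. exact: ffun_map_inj. Qed.

Lemma power_diffE N (K : resolution N) i (w : {ffun 'I_r -> rmod K i.+1}) j :
  rdiff (power_resolution K) i w j = rdiff K i (w j).
Proof. exact: ffun_mapE. Qed.

Lemma hom_cosum_linear U M (g : 'I_r -> Hom U M) :
  linear (fun w : {ffun 'I_r -> U} => \sum_j happ (g j) (w j)).
Proof.
move=> a x y; rewrite scaler_sumr -big_split /=; apply: eq_bigr => j _.
by rewrite !ffunE happD_arg happZ_arg.
Qed.

Definition hom_cosum U M (g : 'I_r -> Hom U M) : Hom {ffun 'I_r -> U} M :=
  to_hom (mklin (hom_cosum_linear g)).

Lemma hom_cosumE U M (g : 'I_r -> Hom U M) w :
  happ (hom_cosum g) w = \sum_j happ (g j) (w j).
Proof. by []. Qed.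

Lemma happ_ffun U M (f : Hom {ffun 'I_r -> U} M) w :
  happ f w = \sum_j happ f (ffun_inj j (w j)).
Proof. by rewrite {1}(ffun_sum_inj w) linear_sum. Qed.

Lemma hom_cosum_inj U M (g : 'I_r -> Hom U M) j x :
  happ (hom_cosum g) (ffun_inj j x) = happ (g j) x.
Proof.
rewrite hom_cosumE (bigD1 j) //= big1 => [|k kj]; first by rewrite addr0 ffunE eqxx.
by rewrite ffunE (negPf kj) happ0_arg.
Qed.

Lemma subquot_ffun B (Z Bd : B -> Prop) (H : lmodType R) : subquot Z Bd H ->
  subquot (fun w : {ffun 'I_r -> B} => forall j, Z (w j))
    (fun w : {ffun 'I_r -> B} => forall j, Bd (w j)) {ffun 'I_r -> H}.
Proof.
move=> [cls S]; exists (fun w : {ffun 'I_r -> B} => [ffun j => cls (w j)]); split.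
- split=> [j|a x y Zx Zy j]; rewrite !ffunE; first exact: (sq_lin S).1.
  exact: (sq_lin S).2.
- by move=> a x y Zx Zy; apply/ffunP => j; rewrite !ffunE (sq_clsP S).
- move=> h; have /choice[x xE] j : exists x, Z x /\ cls x = h j.
    by have [x] := sq_surj S (h j); exists x.
  exists [ffun j => x j] => [j|]; first by rewrite ffunE; have [] := xE j.
  by apply/ffunP => j; rewrite !ffunE; have [] := xE j.
- move=> w Zw; split=> [/ffunP w0 j|wB].
    by apply/(sq_cls0 S (Zw j)); have := w0 j; rewrite !ffunE.
  by apply/ffunP => j; rewrite !ffunE; apply/(sq_cls0 S (Zw j)).
Qed.

(** Hom turns a finite sum in the first argument into a product; this is where the factor in r(R)
    mu_i(M) comes from. *)
Lemma power_cohomology N (K : resolution N) M i :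
  iso (hom_cohomology (power_resolution K) M i)
      {ffun 'I_r -> hom_cohomology K M i}.
Proof.
have uL : linear (fun f : Hom {ffun 'I_r -> rmod K i} M =>
    [ffun j => precomp (ffun_inj j) f] : {ffun 'I_r -> Hom (rmod K i) M}).
  by move=> a f g; apply/ffunP => j; rewrite !ffunE linearP.
apply: (subquot_iso (u := mklin uL) (cohomology_subquot _ _)
  (subquot_ffun (cohomology_subquot _ _))) => /=.
- move=> f /precomp_eq f0 j; apply/precomp_eq => x.
  by rewrite ffunE; have := f0 (ffun_inj j x); rewrite power_diff_inj; apply.
- case: i uL => [|i] _ f _ /=; split.
  + by move=> -> j; rewrite ffunE linear0.
  + move=> f0; apply: hom_ext => w; rewrite happ_ffun happ0 big1 // => j _.
    by have /(congr1 (happ^~ (w j))) := f0 j; rewrite ffunE.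
  + move=> [g /precomp_eq gE] j; exists (precomp (ffun_inj j) g).
    apply/precomp_eq => x; rewrite ffunE.
    by have := gE (ffun_inj j x); rewrite power_diff_inj; apply.
  + move=> /choice[g gE]; exists (hom_cosum g); apply/precomp_eq => w.
    rewrite [RHS]happ_ffun; apply: etrans (hom_cosumE g _) _; apply: eq_bigr => j _.
    have /precomp_eq := gE j; rewrite ffunE => {}gE.
    by rewrite power_diffE -[RHS](gE (w j)).
- move=> y yZ; exists (hom_cosum (fun j => y j)).
    apply/precomp_eq => w; apply: etrans (hom_cosumE _ _) _; rewrite big1 // => j _.
    by rewrite power_diffE; have /precomp_eq -> := yZ j.
  suff -> : [ffun j => precomp (ffun_inj j) (hom_cosum (fun j => y j))] - y = 0.
    case: i {uL} y yZ => [|i] y yZ j; rewrite ffunE //=.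
    by exists 0; rewrite linear0.
  apply/ffunP => j; rewrite !ffunE; apply/eqP; rewrite subr_eq0; apply/eqP.
  by apply: hom_ext => x; rewrite happ_precomp hom_cosum_inj.
Qed.

End Powers.
End FiniteResolutions.

(** * The mapping cone *)

Section Cone.
Context {R : comNzRingType}.
Implicit Types A B P U V M N T : lmodType R.

Definition zero_module : lmodType R := {ffun 'I_0 -> R^o}.

Lemma zero_moduleP (x : zero_module) : x = 0.
Proof. by apply/ffunP => -[]. Qed.

Section Shift.
Variables (N : lmodType R) (L : resolution N).

(** One shift moves N to degree 1, where the homology to be killed sits; the other is the shift in a
    mapping cone. *)
Definition shift2_mod i : lmodType R := if i is j.+2 then rmod L j else zero_module.

Definition shift2_diff i : {linear shift2_mod i.+1 -> shift2_mod i} :=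
  match i return {linear shift2_mod i.+1 -> shift2_mod i} with
  | j.+2 => rdiff L j
  | 1 => \0
  | 0 => \0
  end.

Lemma shift2_diffK i x : shift2_diff i (shift2_diff i.+1 x) = 0.
Proof. by case: i x => [|[|i]] x //; apply: rdiffK. Qed.

Lemma shift2_projective i : projective (shift2_mod i).
Proof.
case: i => [|[|i]]; [exact: projective_zero zero_moduleP.. | exact: rproj].
Qed.

Definition shift2_cochain M i : {linear Hom (shift2_mod i) M -> Hom (shift2_mod i.+1) M} :=
  precomp (shift2_diff i).

(** Only the lowest degree needs an argument: being zero, the meaning of [coboundary] in degree 0,
    must be matched with coming from Hom(0, M). *)
Lemma shift2_cohomology M i H :
  subquot (cocycle (fun j => precomp (rdiff L j) (V := M)) (i := i))
    (coboundary (fun j => precomp (rdiff L j) (V := M)) (i := i)) H ->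
  subquot (cocycle (shift2_cochain M) (i := i.+2))
    (coboundary (shift2_cochain M) (i := i.+2)) H.
Proof.
apply: eq_subquot => // f; case: i f => [|i] f //=.
split=> [->|[g <-]]; first by exists 0; rewrite linear0.
by apply: hom_ext => x; rewrite happ_precomp [shift2_diff 1 x]zero_moduleP linear0.
Qed.

End Shift.

(* phi induces an isomorphism from N = H_0(L) to H_1(D), the only nonzero      *)
(* homology of D in positive degrees, so the cone resolves H_0(D).             *)
Section ConeResolution.
Variables (D : nat -> lmodType R) (dD : forall i, {linear D i.+1 -> D i}).
Variables (N : lmodType R) (L : resolution N).
Variable phi : forall i, {linear rmod L i -> D i.+1}.

Definition cone_phi i : {linear shift2_mod L i.+1 -> D i} :=
  match i return {linear shift2_mod L i.+1 -> D i} with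
  | 0 => \0
  | j.+1 => phi j
  end.

Definition cone_mod i : lmodType R := (D i * shift2_mod L i)%type.

Lemma cone_diff_linear i : linear (fun p : cone_mod i.+1 =>
  (dD i p.1 + cone_phi i p.2, shift2_diff L i p.2) : cone_mod i).
Proof.
move=> a [x y] [x' y'] /=; rewrite !linearP; congr pair.
by rewrite /= scalerDr addrACA.
Qed.

(** The formula carries no sign; instead [phi] is required to anticommute with the differentials,
    which makes the square vanish. *)
Definition cone_diff i : {linear cone_mod i.+1 -> cone_mod i} :=
  mklin (@cone_diff_linear i).

Lemma cone_diffE i x y :
  cone_diff i (x, y) = (dD i x + cone_phi i y, shift2_diff L i y).
Proof. by []. Qed.

Hypothesis dDD : forall i x, dD i (dD i.+1 x) = 0.
Hypothesis dphi0 : forall y, dD 0%N (phi 0%N y) = 0.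
Hypothesis dphi : forall i y, dD i.+1 (phi i.+1 y) = - phi i (rdiff L i y).

Lemma cone_phiP i y : dD i (cone_phi i.+1 y) = - cone_phi i (shift2_diff L i.+1 y).
Proof. by case: i y => [|i] y /=; rewrite ?dphi // dphi0 oppr0. Qed.

Lemma cone_diffK i p : cone_diff i (cone_diff i.+1 p) = 0.
Proof.
case: p => x y; rewrite !cone_diffE linearD dDD add0r cone_phiP addNr.
by rewrite shift2_diffK.
Qed.

Section Resolution.
Variables (T : lmodType R) (aug : {linear D 0%N -> T}).
Hypothesis pD : forall i, projective (D i).
Hypothesis aug_surj : forall t, exists x, aug x = t.
Hypothesis exD0 : forall x, aug x = 0 <-> exists y, dD 0%N y = x.
Hypothesis exD : forall i x, dD i.+1 x = 0 -> exists y, dD i.+2 y = x.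
Hypothesis phi_ker : forall y, raug L y = 0 <-> exists z, dD 1%N z = phi 0%N y.
Hypothesis phi_surj : forall x, dD 0%N x = 0 -> exists y z, x - phi 0%N y = dD 1%N z.

Lemma cone_aug_linear : linear (fun p : cone_mod 0 => aug p.1).
Proof. by move=> a [x y] [x' y'] /=; rewrite linearP. Qed.

Definition cone_resolution : resolution T.
Proof.
refine (@Resolution R T cone_mod cone_diff (mklin cone_aug_linear) _ _ _ _).
- by move=> i; apply: pair_projective; [apply: pD | apply: shift2_projective].
- by move=> t; have [x <-] := aug_surj t; exists (x, 0).
- case=> x y; apply: iff_trans (exD0 x) _; rewrite [y]zero_moduleP.
  split=> [[z <-]|[[z w]]]; first by exists (z, 0); rewrite cone_diffE linear0 addr0.
  by rewrite cone_diffE => -[<-]; exists z; rewrite addr0.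
- move=> i p; split=> [|[q <-]]; last exact: cone_diffK.
  case: p => x y; rewrite cone_diffE => -[].
  (* Once the second component of a cycle is a boundary d y', it remains to see that x' - phi y'
     bounds in D. This is exactness of D, except in degree 1 (i = 0), where a bounding element must
     be supplied. *)
  have main (x' : D i.+1) (y' : shift2_mod L i.+2) :
      dD i (x' - cone_phi i.+1 y') = 0 ->
      (i = 0%N -> exists z, x' - cone_phi i.+1 y' = dD i.+1 z) ->
      exists z, cone_diff i.+1 z = (x', shift2_diff L i.+1 y').
    move=> x'0 i0; suff [z zE] : exists z, dD i.+1 z = x' - cone_phi i.+1 y'.
      by exists (z, y'); rewrite cone_diffE zE subrK.
    case: i {x y} x' y' x'0 i0 => [|i] x' y' x'0 i0; last exact: exD.
    by have [//|z ->] := i0; exists z.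
  (* In degree 1 surjectivity of [phi] onto the homology of D supplies y'; in degree 2 its
     injectivity there makes y a boundary; above, exactness of L does. *)
  case: i x y main => [|[|i]] x y main.
  + rewrite [y]zero_moduleP linear0 addr0 => x0 _.
    have [y' [z zE]] := phi_surj x0.
    have [||q qE] := main x y'; last by exists q; rewrite qE.
      by rewrite linearB x0 dphi0 subrr.
    by move=> _; exists z.
  + move=> xy _; have /rexact0[y' y'E] : raug L y = 0.
      apply/phi_ker; exists (- x); rewrite linearN; apply/eqP.
      by rewrite eq_sym -addr_eq0 addrC; apply/eqP.
    have [//|//|q qE] := main x y'; last by exists q; rewrite qE /= y'E.
    by rewrite linearB dphi y'E opprK.
  + move=> xy /rexact[y' y'E].
    have [//|//|q qE] := main x y'; last by exists q; rewrite qE /= y'E.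
    by rewrite linearB dphi y'E opprK.
Defined.

End Resolution.

Section LongExact.
Variable M : lmodType R.

Definition base_cochain i : {linear Hom (D i) M -> Hom (D i.+1) M} := precomp (dD i).
Definition cone_cochain i : {linear Hom (cone_mod i) M -> Hom (cone_mod i.+1) M} :=
  precomp (cone_diff i).
Local Notation sh_cochain := (shift2_cochain L M).

Lemma cone_inl_linear i : linear (fun x : D i => (x, 0) : cone_mod i).
Proof. by move=> a x y; congr pair; rewrite /= scaler0 addr0. Qed.
Lemma cone_inr_linear i : linear (fun y : shift2_mod L i => (0, y) : cone_mod i).
Proof. by move=> a x y; congr pair; rewrite /= scaler0 addr0. Qed.
Lemma cone_snd_linear i : linear (fun p : cone_mod i => p.2).
Proof. by move=> a [x y] [x' y']. Qed.

(** [cone_res], [cone_inf] and [cone_conn] induce the maps of the long exact sequence; [cone_conn]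
    is the connecting map, raising the degree because [cone_phi] lowers it. *)
Definition cone_res i : {linear Hom (cone_mod i) M -> Hom (D i) M} :=
  precomp (mklin (@cone_inl_linear i)).
Definition cone_inf i : {linear Hom (shift2_mod L i) M -> Hom (cone_mod i) M} :=
  precomp (mklin (@cone_snd_linear i)).
Definition cone_conn i : {linear Hom (D i) M -> Hom (shift2_mod L i.+1) M} :=
  precomp (cone_phi i).

Lemma cone_pair_linear i (a : Hom (D i) M) (b : Hom (shift2_mod L i) M) :
  linear (fun p : cone_mod i => happ a p.1 + happ b p.2).
Proof.
move=> c [x y] [x' y'] /=.
by rewrite !happD_arg !happZ_arg scalerDr addrACA.
Qed.
Definition cone_pair i a b : Hom (cone_mod i) M := to_hom (mklin (@cone_pair_linear i a b)).

Lemma cone_pairE i (a : Hom (D i) M) b x y :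
  happ (cone_pair a b) (x, y) = happ a x + happ b y.
Proof. by []. Qed.

Lemma cone_hom_split i (f : Hom (cone_mod i) M) x y :
  happ f (x, y) = happ f (x, 0) + happ f (0, y).
Proof. by rewrite -happD_arg; congr (happ f _); congr pair; rewrite /= ?addr0 ?add0r. Qed.

Lemma cone_cocycleP i (f : Hom (cone_mod i) M) : cocycle cone_cochain f <->
  forall x y, happ f (dD i x + cone_phi i y, shift2_diff L i y) = 0.
Proof.
rewrite /cocycle precomp_eq.
by split=> [f0 x y|f0 [x y]]; [exact: (f0 (x, y)) | exact: f0].
Qed.

Lemma cone_boundaryP i (f : Hom (cone_mod i.+1) M) : coboundary cone_cochain f <->
  exists g : Hom (cone_mod i) M, forall x y,
    happ g (dD i x + cone_phi i y, shift2_diff L i y) = happ f (x, y).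
Proof.
split=> -[g]; [move/precomp_eq=> gE | move=> gE]; exists g.
  by move=> x y; rewrite -gE.
by apply/precomp_eq => -[x y]; rewrite -gE.
Qed.

Lemma cone_cocycle_parts i (f : Hom (cone_mod i) M) : cocycle cone_cochain f ->
  (forall x, happ f (dD i x, 0) = 0) /\
  (forall y, happ f (cone_phi i y, 0) = - happ f (0, shift2_diff L i y)).
Proof.
move=> /cone_cocycleP f0; split=> [x|y].
  by have := f0 x 0; rewrite !linear0 addr0.
apply/eqP; rewrite -addr_eq0 -cone_hom_split; apply/eqP.
by have := f0 0 y; rewrite linear0 add0r.
Qed.

Lemma cone_res_cocycle i (f : Hom (cone_mod i) M) :
  cocycle cone_cochain f -> cocycle base_cochain (cone_res i f).
Proof. by move=> /cone_cocycle_parts[f0 _]; apply/precomp_eq => x; apply: f0. Qed.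

Lemma cone_res_boundary i (f : Hom (cone_mod i.+1) M) :
  coboundary cone_cochain f -> coboundary base_cochain (cone_res i.+1 f).
Proof.
move=> /cone_boundaryP[g gE]; exists (cone_res i g); apply/precomp_eq => x.
by have := gE x 0; rewrite !linear0 addr0.
Qed.

Lemma cone_res_inj i (f : Hom (cone_mod i.+1) M) :
    (forall b, cocycle sh_cochain (i := i.+1) b -> coboundary sh_cochain b) ->
    cocycle cone_cochain f ->
  coboundary base_cochain (cone_res i.+1 f) -> coboundary cone_cochain f.
Proof.
move=> HB fZ [a /precomp_eq aE]; have [f0 fphi] := cone_cocycle_parts fZ.
(* If f restricts to a d on D, the remaining obstruction to bounding f is f(0, -) - a phi. It is a
   cocycle on the shift, so it bounds by hypothesis. *)
pose b : Hom (shift2_mod L i.+1) M := precomp (mklin (@cone_inr_linear i.+1)) f -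
  cone_conn i a.
have bE y : happ b y = happ f (0, y) - happ a (cone_phi i y) by [].
have [|b' /precomp_eq b'E] := HB b.
  apply/precomp_eq => y; rewrite bE -[happ f _]opprK -fphi happ0.
  have -> : happ f (cone_phi i.+1 y, 0) = happ a (dD i (cone_phi i.+1 y)).
    by rewrite aE.
  by rewrite cone_phiP happN_arg opprK subrr.
apply/cone_boundaryP; exists (cone_pair a b') => x y.
rewrite cone_pairE b'E bE happD_arg aE addrA addrAC addrK.
by rewrite [RHS]cone_hom_split.
Qed.

(** The pair (a, -b) is a cone cocycle exactly when b d = a phi on the shift, so the connecting
    class is the obstruction to extending a. *)
Lemma cone_res_surj i (a : Hom (D i) M) :
    cocycle base_cochain a -> coboundary sh_cochain (cone_conn i a) ->
  exists2 f, cocycle cone_cochain f & cone_res i f = a.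
Proof.
move=> /precomp_eq a0 [b /precomp_eq bE].
exists (cone_pair a (- b)).
  apply/cone_cocycleP => x y; rewrite cone_pairE happD_arg a0 happ0 add0r happN.
  by rewrite bE subrr.
by apply/precomp_eq => x; rewrite cone_pairE happ0_arg addr0.
Qed.

Lemma cone_conn_cocycle i (a : Hom (D i) M) :
  cocycle base_cochain a -> cocycle sh_cochain (cone_conn i a).
Proof.
move=> /precomp_eq a0; apply/precomp_eq => y.
by rewrite happ_precomp -[cone_phi _ _]opprK -cone_phiP happN_arg a0 happ0 oppr0.
Qed.

Lemma cone_res_iso i HE HA :
    subquot (cocycle cone_cochain (i := i.+1)) (coboundary cone_cochain (i := i.+1)) HE ->
    subquot (cocycle base_cochain (i := i.+1)) (coboundary base_cochain (i := i.+1)) HA ->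
    (forall b, cocycle sh_cochain (i := i.+1) b -> coboundary sh_cochain b) ->
    (forall b, cocycle sh_cochain (i := i.+2) b -> coboundary sh_cochain b) ->
  iso HE HA.
Proof.
move=> SE SA HB1 HB2; apply: (subquot_iso (u := cone_res i.+1) SE SA).
- by move=> f; apply: cone_res_cocycle.
- by move=> f fZ; split; [apply: cone_res_boundary | apply: cone_res_inj].
- move=> a aZ; have [|f fZ <-] := cone_res_surj aZ.
    by apply: HB2; apply: cone_conn_cocycle.
  by exists f => //; rewrite subrr; exists 0; rewrite linear0.
Qed.

Lemma cone_inf_cocycle i (b : Hom (shift2_mod L i) M) :
  cocycle sh_cochain b -> cocycle cone_cochain (cone_inf i b).
Proof. by move=> /precomp_eq b0; apply/cone_cocycleP => x y; apply: b0. Qed.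

Lemma cone_inf_boundary i (b : Hom (shift2_mod L i.+1) M) :
  coboundary sh_cochain b -> coboundary cone_cochain (cone_inf i.+1 b).
Proof.
move=> [g /precomp_eq gE]; apply/cone_boundaryP.
by exists (cone_inf i g) => x y; apply: gE.
Qed.

Lemma cone_inf_surj i (f : Hom (cone_mod i) M) :
    (forall x : D i, x = 0) -> cocycle cone_cochain f ->
  exists2 b, cocycle sh_cochain b & cone_inf i b = f.
Proof.
move=> D0 fZ; exists (precomp (mklin (@cone_inr_linear i)) f).
  apply/precomp_eq => y; have [_ fphi] := cone_cocycle_parts fZ.
  have /(congr1 -%R) := fphi y; rewrite opprK [cone_phi i y]D0 => /esym e.
  apply: etrans e _; have -> : ((0, 0) : cone_mod i) = 0 by [].
  by rewrite happ0_arg oppr0.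
apply/precomp_eq => -[x y].
by rewrite [x]D0.
Qed.

Lemma cone_inf_iso i HB HE :
    subquot (cocycle sh_cochain (i := i.+1)) (coboundary sh_cochain (i := i.+1)) HB ->
    subquot (cocycle cone_cochain (i := i.+1)) (coboundary cone_cochain (i := i.+1)) HE ->
    (forall x : D i, x = 0) -> (forall x : D i.+1, x = 0) ->
  iso HB HE.
Proof.
move=> SB SE D0 D1; apply: (subquot_iso (u := cone_inf i.+1) SB SE).
- by move=> b; apply: cone_inf_cocycle.
- move=> b _; split; first exact: cone_inf_boundary.
  move=> /cone_boundaryP[g gE].
  exists (precomp (mklin (@cone_inr_linear i)) g); apply/precomp_eq => y.
  by have := gE 0 y; rewrite [X in (X, _)]D0.
- move=> f fZ; have [b bZ <-] := cone_inf_surj D1 fZ.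
  by exists b => //; rewrite subrr; exists 0; rewrite linear0.
Qed.

(** Injectivity on the left is the vanishing on the shift in degree i + 1. Surjectivity on the right
    holds as D_(i+2) = 0 leaves a cone cocycle only its component on the shift. For i = t the middle
    terms are Tor_0 and Ext^t(k^r, M). *)
Lemma cone_exact4 i HE HA HB HF :
    subquot (cocycle cone_cochain (i := i.+1)) (coboundary cone_cochain (i := i.+1)) HE ->
    subquot (cocycle base_cochain (i := i.+1)) (coboundary base_cochain (i := i.+1)) HA ->
    subquot (cocycle sh_cochain (i := i.+2)) (coboundary sh_cochain (i := i.+2)) HB ->
    subquot (cocycle cone_cochain (i := i.+2)) (coboundary cone_cochain (i := i.+2)) HF ->
    (forall b, cocycle sh_cochain (i := i.+1) b -> coboundary sh_cochain b) ->
    (forall x : D i.+2, x = 0) ->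
  exists (u : {linear HE -> HA}) (v : {linear HA -> HB}) (w : {linear HB -> HF}),
  [/\ injective u, forall x, v x = 0 <-> exists y, u y = x,
      forall x, w x = 0 <-> exists y, v y = x & forall x, exists y, w y = x].
Proof.
move=> [cE SE] [cA SA] [cB SB] [cF SF] HB1 D2.
have [||u uE] := subquot_map (u := cone_res i.+1) SE SA.
- by move=> f; apply: cone_res_cocycle.
- by move=> f _; apply: cone_res_boundary.
have [||v vE] := subquot_map (u := cone_conn i.+1) SA SB.
- by move=> a; apply: cone_conn_cocycle.
- move=> a _ [a' /precomp_eq a'E]; exists (- cone_conn i a'); apply/precomp_eq => y.
  by rewrite happN !happ_precomp -a'E cone_phiP happN_arg.
have [||w wE] := subquot_map (u := cone_inf i.+2) SB SF.
- by move=> b; apply: cone_inf_cocycle.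
- by move=> b _; apply: cone_inf_boundary.
exists u, v, w; split.
- apply: linear_inj => h; have [f fZ <-] := sq_surj SE h.
  rewrite uE // (sq_cls0 SA (cone_res_cocycle fZ)) => fB.
  by apply/(sq_cls0 SE fZ); apply: cone_res_inj.
- move=> h; have [a aZ <-] := sq_surj SA h.
  rewrite vE // (sq_cls0 SB (cone_conn_cocycle aZ)); split.
    move=> /(cone_res_surj aZ)[f fZ <-]; exists (cE f); exact: uE.
  move=> [h' h'E]; have [f fZ fE] := sq_surj SE h'.
  apply/(sq_cls0 SB (cone_conn_cocycle aZ)); rewrite -vE // -h'E -fE uE // vE; last first.
    exact: cone_res_cocycle.
  apply/(sq_cls0 SB (cone_conn_cocycle (cone_res_cocycle fZ))).
  (* The cocycle equation of f on the shift reads f(phi y, 0) = - f(0, d y), which exhibits the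
     connecting image as a coboundary. *)
  exists (- precomp (mklin (@cone_inr_linear i.+1)) f); apply/precomp_eq => y.
  have [_ fphi] := cone_cocycle_parts fZ.
  by rewrite happ_precomp [RHS]fphi.
- move=> h; have [b bZ <-] := sq_surj SB h.
  rewrite wE // (sq_cls0 SF (cone_inf_cocycle bZ)); split.
    move=> /cone_boundaryP[g gE].
    (* If g bounds the inflation of b, its equation on D makes a a cocycle, and its equation on the
       shift says that b and a phi differ by the coboundary of g(0, -). *)
    pose a := cone_res i.+1 g.
    have aZ : cocycle base_cochain a.
      apply/precomp_eq => x; have := gE x 0; rewrite !linear0 addr0 => e.
      exact: etrans e (happ0_arg b).
    exists (cA a); rewrite vE //; apply/(sq_eq SB) => //; first exact: cone_conn_cocycle.
    exists (- precomp (mklin (@cone_inr_linear i.+1)) g); apply/precomp_eq => y.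
    have := gE 0 y; rewrite linear0 add0r cone_hom_split => gy.
    have -> : happ (cone_conn i.+1 a - b) y = happ g (cone_phi i.+1 y, 0) - happ b y by [].
    have -> : happ b y = happ (cone_inf i.+2 b) (0, y) by [].
    by rewrite -gy opprD addrA subrr add0r.
  move=> [h' h'E]; have [a aZ aE] := sq_surj SA h'.
  apply/(sq_cls0 SF (cone_inf_cocycle bZ)); rewrite -wE // -h'E -aE vE // wE; last first.
    exact: cone_conn_cocycle.
  apply/(sq_cls0 SF (cone_inf_cocycle (cone_conn_cocycle aZ))).
  apply/cone_boundaryP; exists (cone_pair a 0) => x y; move/precomp_eq: aZ => aZ.
  by rewrite cone_pairE happD_arg aZ !happ0 addr0 add0r.
- move=> h; have [f fZ <-] := sq_surj SF h.
  have [b bZ <-] := cone_inf_surj D2 fZ.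
  by exists (cB b); rewrite wE.
Qed.

End LongExact.
End ConeResolution.
End Cone.

(** * Vanishing and annihilation of Ext and Tor *)

(** L_0 -> N -> H_1(D) lifts to the cycles of D_1 by projectivity, then extends upwards. Bijectivity
    of [f] becomes the last two clauses, in the form consumed by the cone. *)
Lemma cone_map_exists (R : comNzRingType) (D : nat -> lmodType R)
    (dD : forall i, {linear D i.+1 -> D i}) (N H : lmodType R) (L : resolution N)
    (f : {linear N -> H}) :
    (forall i x, dD i.+1 x = 0 -> exists y, dD i.+2 y = x) ->
    subquot (fun x => dD 0%N x = 0) (fun x => exists z, dD 1%N z = x) H ->
    bijective f ->
  exists phi : forall i, {linear rmod L i -> D i.+1},
  [/\ forall y, dD 0%N (phi 0%N y) = 0,
      forall i y, dD i.+1 (phi i.+1 y) = - phi i (rdiff L i y),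
      forall y, raug L y = 0 <-> exists z, dD 1%N z = phi 0%N y &
      forall x, dD 0%N x = 0 -> exists y z, x - phi 0%N y = dD 1%N z].
Proof.
move=> exD [cls S] [g fK gK].
pose Z1 := submod (kerp (dD 0%N)).
have Z1P (x : Z1) : dD 0%N (submod_val x) = 0 by apply/kerpP/submodP.
have cL : linear (fun x : Z1 => cls (submod_val x)).
  by move=> a x y; apply: (sq_clsP S a (Z1P x) (Z1P y)).
have [|h hE] := projective_lift (f := f \o raug L) (q := mklin cL) (rproj L 0%N).
  move=> x; have [y y0 yE] := sq_surj S (f (raug L x)).
  by exists (Submod (introT (kerpP _ y) y0)).
pose phi0 : {linear rmod L 0%N -> D 1%N} := @submod_val R _ (kerp (dD 0%N)) \o h.
have phi0Z y : dD 0%N (phi0 y) = 0 by apply: Z1P.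
have phi0E y : cls (phi0 y) = f (raug L y) by apply: hE.
have phi_ker y : raug L y = 0 <-> exists z, dD 1%N z = phi0 y.
  rewrite -(sq_cls0 S (phi0Z y)) phi0E; split=> [->|]; first exact: linear0.
  by rewrite -[X in _ = X](linear0 f) => /(can_inj fK).
(* Negating the differentials of L turns a chain map into the anticommuting family required by the
   cone. *)
have [||||phi p0 pC] := @chain_map_lift R (rmod L) (fun i => D i.+1)
  (fun i => \- rdiff L i) (fun i => dD i.+1) phi0.
- exact: rproj.
- by move=> i x /=; rewrite linearN rdiffK !oppr0.
- exact: exD.
- by move=> x; apply/phi_ker; rewrite /= linearN raugK oppr0.
exists phi; rewrite p0; split=> // [i y|x x0].
- by rewrite pC /= linearN.
- have [y yE] := raug_surj L (g (cls x)).
  have /(sq_eq S x0 (phi0Z y))[z zE] : cls x = cls (phi0 y) by rewrite phi0E yE gK.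
  by exists y, z.
Qed.

(** * Reversing and truncating a cochain complex *)

Section Reverse.
Context {R : comNzRingType}.
Variables (C : nat -> lmodType R) (dC : forall i, {linear C i -> C i.+1}).
Implicit Types M : lmodType R.

(* C_n <- C_(n-1) <- ... <- C_0 <- 0 <- ..., graded so that C_n sits in degree 0. *)
Fixpoint rev_mod n i {struct i} : lmodType R :=
  match i with
  | 0 => C n
  | i'.+1 => if n is n'.+1 then rev_mod n' i' else zero_module
  end.

(** Peeling both indices together makes [rev_mod n.+1 i.+1] convert to [rev_mod n i]; an index n - i
    would need transports. *)
Fixpoint rev_diff n i {struct i} : {linear rev_mod n i.+1 -> rev_mod n i} :=
  match i return {linear rev_mod n i.+1 -> rev_mod n i} with
  | 0 => match n return {linear rev_mod n 1 -> rev_mod n 0} with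
         | 0 => \0
         | n'.+1 => dC n'
         end
  | i'.+1 => match n return {linear rev_mod n i'.+2 -> rev_mod n i'.+1} with
             | 0 => \0
             | n'.+1 => rev_diff n' i'
             end
  end.

Lemma rev_projective n i : (forall j, projective (C j)) -> projective (rev_mod n i).
Proof.
move=> pC; elim: i n => [|i IHi] [|n] //=; exact: projective_zero zero_moduleP.
Qed.

Lemma rev_diffK n i x : (forall j y, dC j.+1 (dC j y) = 0) ->
  rev_diff n i (rev_diff n i.+1 x) = 0.
Proof.
move=> dCK; elim: i n x => [|i IHi] [|[|n]] x //=; rewrite ?linear0 //.
all: by [apply: dCK | apply: IHi].
Qed.

Lemma rev_zero n i (x : rev_mod n i) : (n < i)%N -> x = 0.
Proof.
elim: i n x => [//|i IHi] [|n] x ni; first exact: zero_moduleP.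
exact: IHi.
Qed.

Lemma rev_boundary n (x : C n) :
  coboundary dC x <-> exists y, rev_diff n 0 y = x.
Proof. by case: n x => [|n] x //=; split=> [->|[y <-]] //; exists 0. Qed.

Lemma rev_exact n i (x : rev_mod n i.+1) :
    (forall j, (j < n)%N -> forall y, cocycle dC (i := j) y -> coboundary dC y) ->
  rev_diff n i x = 0 -> exists y, rev_diff n i.+1 y = x.
Proof.
elim: i n x => [|i IHi] [|n] x exC.
- by move=> _; exists 0; rewrite linear0 [RHS]zero_moduleP.
- by move=> /(exC n (ltnSn n))/rev_boundary.
- by move=> _; exists 0; rewrite linear0 [RHS]zero_moduleP.
- by apply: IHi => j jn; apply: exC; apply: ltnW.
Qed.

(** Reversal puts C_(n-i-1) in degree i + 1, so n = t + 1 pairs Ext-degree i + 1 with Tor_(t-i).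
    Degree 0 is excluded: the complex is cut off there. *)
Lemma rev_cohomology M n i H : (i < n)%N ->
    subquot (chain_cycle (fun j => precomp (V := M) (dC j)) (i := n - i.+1))
      (chain_boundary (fun j => precomp (V := M) (dC j)) (i := n - i.+1)) H ->
  subquot (cocycle (base_cochain (rev_diff n) M) (i := i.+1))
    (coboundary (base_cochain (rev_diff n) M) (i := i.+1)) H.
Proof.
elim: i n => [|i IHi] [|n] // ni; last by rewrite subSS; apply: IHi.
rewrite subn1 /=; apply: eq_subquot => // x.
case: n {ni} x => [|n] x; split=> // _.
by apply/precomp_eq => y; rewrite linear0.
Qed.

End Reverse.

(** * Annihilators of N kill Ext and Tor *)

Section Annihilation.
Context {R : comNzRingType}.
Implicit Types M N V B H : lmodType R.

Definition scale_lin (a : R) V : {linear V -> V} := a \*: (idfun : {linear V -> V}).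

(** Multiplication by [a] lifts the zero map of [N]. Having the homotopy itself, it can be pushed
    through Hom and through the double dual. *)
Lemma kill_homotopy N (K : resolution N) a :
  (forall x : N, a *: x = 0) ->
  null_homotopic (rdiff K) (rdiff K) (fun i x => a *: x).
Proof.
move=> aN; apply: (@resolution_null _ N K (fun i => scale_lin a (rmod K i))) => [i x|x] /=.
  exact: linearZ.
by rewrite linearZ /= aN.
Qed.

Lemma cochain_kill N (K : resolution N) M a i (f : Hom (rmod K i) M) :
    (forall x : N, a *: x = 0) ->
    cocycle (fun j => precomp (rdiff K j)) f ->
  coboundary (fun j => precomp (V := M) (rdiff K j)) (a *: f).
Proof.
move=> /(kill_homotopy K)[s [s0 sS]] /precomp_eq f0.
case: i f f0 => [|i] f f0 /=.
  by apply: hom_ext => x; rewrite happZ -happZ_arg s0 f0.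
exists (precomp (s i) f); apply/precomp_eq => x.
by rewrite happ_precomp happZ -happZ_arg sS happD_arg f0 add0r.
Qed.

Lemma bidual_kill N (K : resolution N) M a i (f : Hom (dual (rmod K i)) M) :
    (forall x : N, a *: x = 0) ->
    chain_cycle (fun j => precomp (V := M) (dual_map (rdiff K j))) f ->
  chain_boundary (fun j => precomp (V := M) (dual_map (rdiff K j))) (a *: f).
Proof.
move=> /(kill_homotopy K)[s [s0 sS]] f0.
exists (precomp (dual_map (s i)) f); apply/precomp_eq => psi.
rewrite happ_precomp happZ -happZ_arg.
case: i f f0 psi => [|i] f f0 psi.
  congr (happ f _); apply: hom_ext => x.
  by rewrite happZ -happZ_arg s0.
have -> : a *: psi = dual_map (s i.+1) (dual_map (rdiff K i.+1) psi) +
    dual_map (rdiff K i) (dual_map (s i) psi).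
  by apply: hom_ext => x; rewrite happZ -happZ_arg sS happD_arg.
by rewrite happD_arg; move/precomp_eq: f0 => ->; rewrite addr0.
Qed.

Variable m : submodClosed R^o.

Lemma subquot_kspace B H (Z Bd : B -> Prop) : subquot Z Bd H ->
  (forall a x, a \in m -> Z x -> Bd (a *: x)) -> is_kspace m H.
Proof.
move=> [cls S] kB a h am; have [x Zx <-] := sq_surj S h.
rewrite -(sq_clsZ a S Zx); apply/(sq_cls0 S); last exact: kB.
exact: linear_predZ (sq_lin S) Zx.
Qed.

Lemma hom_cohomology_kspace N (K : resolution N) M i :
  is_kspace m N -> is_kspace m (hom_cohomology K M i).
Proof.
move=> kN; apply: (subquot_kspace (cohomology_subquot _ _)) => a f am.
by apply: cochain_kill => x; apply: kN.
Qed.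

Lemma bidual_homology_kspace N (K : resolution N) M i :
  is_kspace m N -> is_kspace m (bidual_homology M K i).
Proof.
move=> kN; apply: (subquot_kspace (chain_homology_subquot _ _)) => a f am.
by apply: bidual_kill => x; apply: kN.
Qed.

End Annihilation.

(** * Vanishing of Ext below the depth *)

Section Depth.
Context {R : comNzRingType}.
Implicit Types M N : lmodType R.

(* The first clause of [regular_seq], with the quotients taken one at a time. *)
Fixpoint weakly_regular (xs : seq R) M : Prop :=
  if xs is x :: xs' then
    (forall v : M, x *: v = 0 -> v = 0) /\
    weakly_regular xs' (quotmod (imp (scale_lin x M)))
  else True.

Lemma in_idealM_cons x xs M (v : M) :
  in_idealM (x :: xs) v <-> exists w, in_idealM xs (v - x *: w).
Proof.
split=> [[y ->]|[w [y yE]]].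
  exists (y 0%N), (fun j => y j.+1).
  by rewrite /= big_ord_recl /= addrC addKr.
exists (fun j => if j is j'.+1 then y j' else w).
by rewrite /= big_ord_recl /= -[LHS](subrK (x *: w)) yE addrC.
Qed.

(** Moves one element of the sequence into the module, turning the simultaneous definition of
    regularity into the recursive one. *)
Lemma in_idealM_quot xs M x (v : M) :
  in_idealM xs (quot_pi (imp (scale_lin x M)) v) <-> in_idealM (x :: xs) v.
Proof.
rewrite in_idealM_cons; split=> [[y yE]|[w [y yE]]].
  have /choice[z zE] := fun j => quot_pi_surj (y j).
  have /quot_pi_eq0/impP[w wE] :
      quot_pi (imp (scale_lin x M)) (v - \sum_(j < size xs) xs`_j *: z j) = 0.
    rewrite linearB /= yE linear_sum -sumrB big1 // => j _.
    by rewrite linearZ /= zE subrr.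
  by exists w, z; rewrite -[x *: w]/(scale_lin x M w) wE opprB addrC subrK.
exists (fun j => quot_pi (imp (scale_lin x M)) (y j)).
have -> : quot_pi (imp (scale_lin x M)) v = quot_pi (imp (scale_lin x M)) (v - x *: w).
  apply/esym/eqP; rewrite linearB /= subr_eq addrC -subr_eq subrr eq_sym.
  by apply/eqP/quot_pi_eq0/impP; exists w.
by rewrite yE linear_sum; apply: eq_bigr => j _; rewrite linearZ.
Qed.

Lemma regular_weakly_regular xs M :
    (forall i, (i < size xs)%N -> forall v : M,
      in_idealM (take i xs) (xs`_i *: v) -> in_idealM (take i xs) v) ->
  weakly_regular xs M.
Proof.
elim: xs M => [//|x xs IHxs] M xsR; split=> [v xv|].
  have [|y ->] := xsR 0%N isT v; last by rewrite big_ord0.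
  by exists (fun=> 0); rewrite big_ord0.
apply: IHxs => i ix v; have [w <-] := quot_pi_surj v.
rewrite -linearZ => /in_idealM_quot wx; apply/in_idealM_quot.
exact: (xsR i.+1).
Qed.

(** The classical induction along 0 -> M -> M -> M/xM -> 0, using that x kills Ext(N, M), carried
    out on cocycles instead of through a long exact sequence. *)
Lemma weakly_regular_vanishing N (K : resolution N) xs M i (f : Hom (rmod K i) M) :
    (forall x, x \in xs -> forall y : N, x *: y = 0) ->
    weakly_regular xs M -> (i < size xs)%N ->
    cocycle (fun j => precomp (rdiff K j)) f ->
  coboundary (fun j => precomp (V := M) (rdiff K j)) f.
Proof.
elim: xs M i f => [//|x xs IHxs] M i f xN [xI xR] ix /precomp_eq f0.
have [s [s0 sS]] := kill_homotopy K (xN x (mem_head _ _)).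
case: i f ix f0 => [|i] f ix f0 /=.
  by apply: hom_ext => y; apply: xI; rewrite -happZ_arg s0 f0.
pose q := quot_pi (imp (scale_lin x M)).
(* Since f d = 0, the homotopy x = d s + s d gives x f = (f s) d. *)
have [g gE] : exists g : Hom (rmod K i) M,
    forall y, happ g (rdiff K i y) = x *: happ f y.
  exists (precomp (s i) f) => y.
  by rewrite happ_precomp -happZ_arg sS happD_arg f0 add0r.
(* Modulo x, g becomes a cocycle one degree lower, where the shorter sequence on M/xM applies. *)
have gB : coboundary (fun j => precomp (rdiff K j)) (postcomp q g).
  apply: (IHxs _ _ _ _ xR ix) => [z zxs|].
    by apply: xN; rewrite in_cons zxs orbT.
  apply/precomp_eq => y; rewrite -[LHS]/(q (happ g (rdiff K i y))) gE.
  by apply/quot_pi_eq0/impP; exists (happ f y).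
(* A cochain bounding g modulo x lifts to M by projectivity; subtracting its coboundary puts the
   values of g in xM. In degree 0 a coboundary is zero, so g already has them there. *)
have [g' g'E g'x] : exists2 g' : Hom (rmod K i) M,
    (forall y, happ g' (rdiff K i y) = happ g (rdiff K i y)) &
    forall y, q (happ g' y) = 0.
  case: {s s0 sS} i f f0 ix g gE gB => [|i] f f0 ix g gE gB.
    exists g => // y; have /(congr1 (happ^~ y)) := gB.
    by rewrite happ0.
  have [h /precomp_eq hE] := gB.
  have [h' h'E] := projective_lift (f := happ h) (rproj K i) (fun y => quot_pi_surj (happ h y)).
  exists (g - precomp (rdiff K i) (to_hom h')) => y.
    by rewrite happD happN happ_precomp rdiffK happ0_arg subr0.
  have qB a b : q (a - b) = q a - q b by apply: (linearB (quot_pi _)).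
  rewrite happD happN qB.
  apply/eqP; rewrite subr_eq0; apply/eqP.
  exact: etrans (esym (hE y)) (esym (h'E _)).
(* Dividing g' by x gives k with x k d = x f, and x cancels. *)
have [||k kE] := lift_linear (f := happ g') (q := scale_lin x M).
- by apply: linear_inj => v; apply: xI.
- by move=> y; have /quot_pi_eq0/impP := g'x y.
exists (to_hom k); apply/precomp_eq => y; apply/eqP; rewrite -subr_eq0; apply/eqP.
apply: xI; rewrite scalerBr -gE -g'E; apply/eqP; rewrite subr_eq0; apply/eqP.
exact: kE.
Qed.

Lemma depth_vanishing m N (K : resolution N) n M i (f : Hom (rmod K i) M) :
    is_kspace m N -> depth_ge m M n -> (i < n)%N ->
    cocycle (fun j => precomp (rdiff K j)) f ->
  coboundary (fun j => precomp (V := M) (rdiff K j)) f.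
Proof.
move=> kN [M0|[xs [<- xm [xsR _]]]] ix fZ.
  have -> : f = 0 by apply: hom_ext => x; apply: etrans (M0 _) (esym (M0 _)).
  by case: i {f ix fZ} => [|i] //=; exists 0; rewrite linear0.
apply: (weakly_regular_vanishing _ (regular_weakly_regular xsR) ix fZ) => x xxs y.
by apply: kN; apply: xm.
Qed.

End Depth.

(** * The theorem *)

Section MainComputation.
Context {R : comNzRingType}.
Variables (m : submodClosed R^o) (t : nat) (M : lmodType R).
Variable F : resolution (residue_field m).
Hypotheses (Rn : noetherian R) (mM : maximal_ideal m).
Hypotheses (Rt : depth_ge m R^o t) (Mt : depth_ge m M t).
Hypotheses (Mf : fingen M) (Ff : fg_resolution F).

Local Notation k := (residue_field m).

Lemma hom_cohomology_fingen N i : fingen N -> fingen (hom_cohomology F N i).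
Proof.
move=> Nf; apply: (fingen_subquot Rn (cohomology_subquot _ _)).
exact: fingen_Hom.
Qed.

Lemma bass_iso N i : bass m i N = kdim m (hom_cohomology F N i).
Proof. exact: iso_kdim (Ext_iso F N i). Qed.

(** Rules out the default value 0 of [kdim], so that Bass numbers are genuine dimensions. *)
Lemma hom_cohomology_has_kdim N i : fingen N ->
  has_kdim m (hom_cohomology F N i) (bass m i N).
Proof.
move=> Nf.
have kH : is_kspace m (hom_cohomology F N i).
  by apply: hom_cohomology_kspace; apply: residue_kspace.
have [n [b B]] := kbasis_exists mM (hom_cohomology_fingen i Nf) kH.
have Hn := kbasis_has_kdim B; rewrite card_ord in Hn.
by rewrite bass_iso (kdim_eq mM Hn).
Qed.

Lemma power_kdim r i :
  kdim m (hom_cohomology (power_resolution r F) M i) = (r * bass m i M)%N.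
Proof.
rewrite (iso_kdim m (power_cohomology r F M i)).
have [b B] := has_kdim_basis (hom_cohomology_has_kdim i Mf).
have [b' B'] := kbasis_ffun r B.
by rewrite (kbasis_kdim mM B') card_prod !card_ord.
Qed.

Lemma betti_iso i : betti m i M = kdim m (bidual_homology M F i).
Proof. exact: iso_kdim (Tor_bidual M i Ff). Qed.

Definition dual_cochain i : {linear dual (rmod F i) -> dual (rmod F i.+1)} :=
  dual_map (rdiff F i).

Local Notation D := (rev_mod (fun i => dual (rmod F i)) t.+1).
Local Notation dD := (rev_diff dual_cochain t.+1).
Local Notation r := (bass m t R^o).
Local Notation L := (power_resolution r F).

Lemma dual_cochain_exact j : (j < t)%N -> forall y,
  cocycle dual_cochain (i := j) y -> coboundary dual_cochain y.
Proof.
move=> jt y; exact: (@depth_vanishing R m k F t R^o j y (@residue_kspace R m) Rt jt).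
Qed.

(** From degree 1 on, [dD] converts to [rev_diff] with t in place of t + 1. The spot of Ext^t(k, R)
    is thereby left out, and the remaining ones vanish by the depth of R. *)
Lemma base_exact i x : dD i.+1 x = 0 -> exists y, dD i.+2 y = x.
Proof. by apply: (rev_exact (n := t)); apply: dual_cochain_exact. Qed.

Lemma base_H1 : subquot (fun x => dD 0%N x = 0) (fun x => exists z, dD 1%N z = x)
  (hom_cohomology F R^o t).
Proof.
refine (@eq_subquot R (dual (rmod F t)) _ _ _ _ _ _ _
  (cohomology_subquot dual_cochain t)) => x //.
exact: rev_boundary.
Qed.

(** [phi] and the equality of cohomologies are exported because the existential hides that [Q] is a
    cone. *)
Lemma cone_exists : exists Q : resolution (dual_coker F t),
  exists phi : forall i, {linear rmod L i -> D i.+1},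
  [/\ forall y, dD 0%N (phi 0%N y) = 0,
      forall i y, dD i.+1 (phi i.+1 y) = - phi i (rdiff L i y) &
      forall i, hom_cohomology Q M i = cochain_cohomology (cone_cochain dD phi M) i].
Proof.
(* [r] is by definition the dimension of Ext^t(k, R) = H_1(D), so f identifies k^r with the homology
   to be killed. *)
have [f fB] := hom_cohomology_has_kdim t fingen_ring.
have [phi [p0 pS pker psurj]] := cone_map_exists L base_exact base_H1 fB.
have dDK i x : dD i (dD i.+1 x) = 0.
  apply: rev_diffK => j y; apply: hom_ext => z.
  by rewrite !happ_precomp rdiffK linear0.
have pD i : projective (D i).
  apply: rev_projective => j; apply: has_dual_basis_projective.
  by apply: dual_has_dual_basis; apply: projective_dual_basis (rproj F j).
have exD0 (x : D 0%N) : quot_pi (imp (dual_map (rdiff F t))) x = 0 <->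
    exists y, dD 0%N y = x.
  by rewrite quot_pi_eq0; split=> /impP.
exists (cone_resolution dDK p0 pS pD (quot_pi_surj (S := _)) exD0 base_exact pker psurj).
by exists phi.
Qed.

Lemma cone_dims (Q : resolution (dual_coker F t))
    (phi : forall i, {linear rmod L i -> D i.+1}) :
    (forall y, dD 0%N (phi 0%N y) = 0) ->
    (forall i y, dD i.+1 (phi i.+1 y) = - phi i (rdiff L i y)) ->
    (forall i, hom_cohomology Q M i = cochain_cohomology (cone_cochain dD phi M) i) ->
  [/\ forall i, is_kspace m (hom_cohomology Q M i.+1),
      forall i, (i < t)%N -> kdim m (hom_cohomology Q M i.+1) = betti m (t - i) M,
      (kdim m (hom_cohomology Q M t.+1) + r * bass m t M =
       betti m 0 M + kdim m (hom_cohomology Q M t.+2))%N &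
      forall j, (t <= j)%N ->
        kdim m (hom_cohomology Q M j.+3) = (r * bass m j.+1 M)%N].
Proof.
move=> p0 pS QE.
have kk : is_kspace m k by apply: residue_kspace.
have SE i : subquot (cocycle (cone_cochain dD phi M) (i := i))
    (coboundary (cone_cochain dD phi M) (i := i)) (hom_cohomology Q M i).
  by rewrite QE; apply: cohomology_subquot.
have SA i : (i < t.+1)%N -> subquot (cocycle (base_cochain dD M) (i := i.+1))
    (coboundary (base_cochain dD M) (i := i.+1)) (bidual_homology M F (t - i)).
  move=> it; apply: rev_cohomology => //; rewrite subSS.
  exact: chain_homology_subquot.
have SB j := shift2_cohomology (cohomology_subquot (fun i => precomp (V := M) (rdiff L i)) j).
have kA j : is_kspace m (bidual_homology M F j) by apply: bidual_homology_kspace.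
have kB j : is_kspace m (hom_cohomology L M j).
  by apply: hom_cohomology_kspace => a x am; apply/ffunP => i; rewrite !ffunE kk.
(* Degree i + 1 of the shift is zero for i = 0 and otherwise computes Ext^(i-1)(k^r, M), with i - 1
   below the depth of M. *)
have vB i : (i <= t)%N -> forall b, cocycle (shift2_cochain L M) (i := i.+1) b ->
    coboundary (shift2_cochain L M) b.
  case: i => [|i] it b bZ.
    by exists 0; apply: hom_ext => x; rewrite [x]zero_moduleP !linear0.
  apply: (subquot_zero_inv (SB i)) bZ.
  apply: (subquot_zero (cohomology_subquot _ _)) => f.
  apply: (depth_vanishing (m := m) _ Mt it).
  by move=> a x am; apply/ffunP => j; rewrite !ffunE kk.
(* D ends with the dual of F_0, in degree t + 1. *)
have D0 i : (t.+1 < i)%N -> forall x : D i, x = 0.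
  by move=> it x; apply: rev_zero it.
(* The shift must be acyclic in both degrees i + 1 and i + 2, hence the strict bound. *)
have isoA i : (i < t)%N ->
    iso (hom_cohomology Q M i.+1) (bidual_homology M F (t - i)).
  move=> it; apply: (cone_res_iso p0 pS (SE _) (SA i _) (vB _ _) (vB _ _)) => //.
  exact: ltnW.
  exact: ltnW.
have isoB j : (t <= j)%N -> iso (hom_cohomology L M j.+1) (hom_cohomology Q M j.+3).
  move=> tj; apply: (cone_inf_iso (i := j.+2) (SB j.+1) (SE j.+3)) => //; apply: D0.
    by rewrite !ltnS.
  by rewrite !ltnS ltnW.
have [u [v [w [uI uv vw wS]]]] := cone_exact4 p0 pS (SE t.+1) (SA t (ltnSn t)) (SB t)
  (SE t.+2) (vB t (leqnn t)) (D0 t.+2 (ltnSn _)).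
split.
- move=> i; have [it|] := ltnP i t; first exact: iso_kspace (isoA i it) (kA _).
  rewrite leq_eqVlt => /orP[/eqP <-|]; first exact: kspace_inj uI (kA _).
  case: i => // i; rewrite ltnS leq_eqVlt => /orP[/eqP <-|].
    exact: kspace_surj wS (kB _).
  by case: i => // i ti; apply: iso_kspace (iso_sym (isoB i ti)) (kB _).
- by move=> i it; rewrite betti_iso; apply: iso_kdim; apply: isoA.
- rewrite betti_iso -power_kdim -(subnn t).
  apply: (kdim_exact4 mM Rn _ _ (kA _) (kB _) uI uv vw wS).
    apply: (fingen_subquot Rn (chain_homology_subquot _ _)).
    apply: fingen_Hom => //; apply: has_dual_basis_fingen.
    by apply: dual_has_dual_basis; apply: projective_dual_basis (rproj F _).
  apply: (fingen_subquot Rn (cohomology_subquot _ _)).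
  by apply: fingen_Hom => //; apply: fingen_ffun.
- by move=> j tj; rewrite -power_kdim; apply/esym/iso_kdim/isoB.
Qed.

End MainComputation.

(** [is_depth] characterises the whole interval of n up to t, so the depth chosen by [xget] can only
    be t. *)
Lemma ring_typeE (R : comNzRingType) (m : submodClosed R^o) t :
  is_depth m R^o t -> ring_type m = bass m t R^o.
Proof.
move=> Rt; congr (bass m _ _); apply: xget_unique => // t' Rt'.
apply/eqP; rewrite eqn_leq; apply/andP.
by split; [apply/Rt/Rt' | apply/Rt'/Rt].
Qed.

Theorem theorem3p4 (R : comNzRingType) (m : submodClosed R^o) (t : nat)
    (M X : lmodType R) (p : presentation X) :
  noetherian R -> local_ring m -> is_depth m R^o t ->
  fingen M -> depth_ge m M t ->
  is_syzygy t (residue_field m) X ->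
  [/\ forall i : nat, (0 < i)%N -> is_kspace m (Ext i (transpose p) M),
      forall i : nat, (1 <= i <= t)%N ->
        kdim m (Ext i (transpose p) M) = betti m (t - i + 1) M,
      (kdim m (Ext (t + 1) (transpose p) M))%:Z
        - (kdim m (Ext (t + 2) (transpose p) M))%:Z
      = (betti m 0 M)%:Z - (ring_type m)%:Z * (bass m t M)%:Z
    & forall i : nat, (t + 3 <= i)%N ->
        kdim m (Ext i (transpose p) M) = (ring_type m * bass m (i - 2) M)%N].
Proof.
move=> Rn [mM _] Rt Mf Mt S.
have [F Ff ->] := transpose_resolution p Rn S.
have Rt' : depth_ge m R^o t by apply/Rt.
have [Q [phi [p0 pS QE]]] := cone_exists M Rn mM Rt' Ff.
have [kE dE d1 dB] := cone_dims Rn mM Mt Mf Ff p0 pS QE.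
have EQ i := Ext_iso Q M i.
rewrite (ring_typeE Rt); split.
- by case=> // i _; apply: iso_kspace (EQ _) (kE i).
- case=> // i it; rewrite (iso_kdim m (EQ _)) dE //.
  by congr (betti m _ M); rewrite addn1 subnSK.
- rewrite addn1 addn2 (iso_kdim m (EQ t.+1)) (iso_kdim m (EQ t.+2)).
  apply/eqP; rewrite subr_eq addrAC eq_sym subr_eq eq_sym; apply/eqP.
  by rewrite -PoszM -!PoszD d1.
- move=> i; rewrite addn3; case: i => [|[|[|j]]] //; rewrite !ltnS => tj.
  by rewrite (iso_kdim m (EQ _)) dB // subn2.
Qed.
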